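(* The integral surfaces of the distribution $\Delta$ of any bi-umbilical hypersurface $\mathcal M^n\subset\mathbb R^{n+1}$ ($n\ge 3$) of type number two are (open parts of) two-dimensional spheres. Conversely, any two-dimensional sphere generates a family of bi-umbilical hypersurfaces of type number two.
   Context: Considerations are local, and hypersurfaces are regular. A regular hypersurface $\mathcal M^n$ in Euclidean space $\mathbb R^{n+1}$ ($n\ge3$) is of type number two if at each point its shape operator has two nonzero eigenvalues $\nu_1,\nu_2$ (possibly equal) and the other $n-2$ eigenvalues are zero. $\Delta=\mathrm{span}\{X,Y\}$ is the two-dimensional distribution on $\mathcal M^n$ spanned by orthogonal unit eigenvector fields $X,Y$ corresponding to $\nu_1,\nu_2$. A hypersurface of type number two is bi-umbilical if $\nu_1(p)=\nu_2(p)\neq0$ at every point $p\in\mathcal M^n$. An integral surface of $\Delta$ is a two-dimensional surface in $\mathcal M^n$ whose tangent plane at each point is the corresponding plane of $\Delta$. The word ''generates'' refers to the following construction. Let $z=z(u,v)$, $(u,v)\in\mathcal D$, parameterize a two-dimensional sphere in some $\mathbb R^3\subset\mathbb R^{n+1}$ with unit normal field $\bar N$ in $\mathbb R^3$; let $\{e,e_2,\dots,e_{n-2}\}$ be a constant orthonormal basis of the orthogonal complement $\mathbb R^{n-2}$ of this $\mathbb R^3$; for a constant $\alpha$ put $e_1=-\sin\alpha\,\bar N+\cos\alpha\,e$. The hypersurfaces generated by the sphere are those given by $z(u,v)+\sum_{\beta=1}^{n-2}w^\beta e_\beta$, with $(u,v)\in\mathcal D$, $w^\beta\in\mathbb R$,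 subject to the regularity assumed of all hypersurfaces here.
   Formalization: The constant α in the generating construction is required to satisfy cos α ≠ 0; for cos α = 0 the generated hypersurface is an open part of a hyperplane, with zero shape operator, so it is not of type number two. *)

(* Defs.v *)
From mathcomp Require Import all_boot all_order all_algebra.
From mathcomp Require Import all_classical all_reals all_analysis.

Set Implicit Arguments.
Unset Strict Implicit.
Unset Printing Implicit Defensive.

Import Order.TTheory GRing.Theory Num.Theory.
Import numFieldNormedType.Exports.

Local Open Scope classical_set_scope.
Local Open Scope ring_scope.

(* Vectors are rows. The topology of 'rV[R]_n (sup norm) is the usual one; the
   Euclidean geometry is carried by the inner product [dot]. *)
Definition dot (R : realType) (n : nat) (x y : 'rV[R]_n) : R :=
  \sum_(i < n) x 0 i * y 0 i.

(* Only meaningful for open U: f is C^(k+1) when it is differentiable and all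
   its directional derivatives are C^k. *)
Fixpoint Ck (R : realType) (m n k : nat) (U : set 'rV[R]_m)
    (f : 'rV[R]_m -> 'rV[R]_n) : Prop :=
  if k is k'.+1 then
    (forall p, U p -> differentiable f p) /\
    (forall v : 'rV[R]_m, Ck k' U (fun p => 'D_v f p))
  else forall p, U p -> {for p, continuous f}.

Definition smooth (R : realType) (m n : nat) (U : set 'rV[R]_m)
    (f : 'rV[R]_m -> 'rV[R]_n) : Prop :=
  forall k, Ck k U f.

(* 'J f p acts on tangent row vectors from the right, so its rows are the
   partial derivatives of f at p and its row space is the tangent space. *)
Definition regular_patch (R : realType) (m n : nat) (U : set 'rV[R]_m)
    (f : 'rV[R]_m -> 'rV[R]_n) : Prop :=
  [/\ open U, smooth U f & forall p, U p -> row_free ('J f p)].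

Definition unit_normal (R : realType) (m n : nat) (U : set 'rV[R]_m)
    (f N : 'rV[R]_m -> 'rV[R]_n) : Prop :=
  [/\ smooth U N, forall p, U p -> dot (N p) (N p) = 1
    & forall p, U p -> forall v : 'rV[R]_m, dot (v *m 'J f p) (N p) = 0].

Definition hypersurface (R : realType) (n : nat) (U : set 'rV[R]_n)
    (f N : 'rV[R]_n -> 'rV[R]_n.+1) : Prop :=
  regular_patch U f /\ unit_normal U f N.

(* Matrix, in the coordinate frame of the patch, of the endomorphism
   df(v) |-> - dN(v) of the tangent space. On a hypersurface it is the only S
   such that S *m 'J f p = - 'J N p. *)
Definition shape_operator (R : realType) (n : nat)
    (f N : 'rV[R]_n -> 'rV[R]_n.+1) (p : 'rV[R]_n) : 'M[R]_n :=
  - 'J N p *m pinvmx ('J f p).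

(* Eigenvalues are counted with multiplicity. *)
Definition nonzero_curvatures (R : realType) (n : nat)
    (f N : 'rV[R]_n -> 'rV[R]_n.+1) (p : 'rV[R]_n) (nu1 nu2 : R) : Prop :=
  [/\ nu1 != 0, nu2 != 0
    & char_poly (shape_operator f N p) =
      ('X - nu1%:P) * ('X - nu2%:P) * 'X^(n - 2)].

Definition type_number_two (R : realType) (n : nat) (U : set 'rV[R]_n)
    (f N : 'rV[R]_n -> 'rV[R]_n.+1) : Prop :=
  hypersurface U f N /\
  forall p, U p -> exists nu1 nu2, nonzero_curvatures f N p nu1 nu2.

Definition bi_umbilical (R : realType) (n : nat) (U : set 'rV[R]_n)
    (f N : 'rV[R]_n -> 'rV[R]_n.+1) : Prop :=
  type_number_two U f N /\
  forall p, U p ->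
  forall nu1 nu2, nonzero_curvatures f N p nu1 nu2 -> nu1 = nu2.

(* X and Y are the coordinates of orthonormal tangent vectors; their span is
   the plane Delta(p). *)
Definition Delta_frame (R : realType) (n : nat)
    (f N : 'rV[R]_n -> 'rV[R]_n.+1) (p X Y : 'rV[R]_n) : Prop :=
  [/\ dot (X *m 'J f p) (X *m 'J f p) = 1,
      dot (Y *m 'J f p) (Y *m 'J f p) = 1,
      dot (X *m 'J f p) (Y *m 'J f p) = 0
    & exists nu1 nu2, [/\ nonzero_curvatures f N p nu1 nu2,
        X *m shape_operator f N p = nu1 *: X
      & Y *m shape_operator f N p = nu2 *: Y]].

(* The surface is f \o s. Equality of its tangent plane with the plane Delta
   makes it an immersion. *)
Definition integral_surface (R : realType) (n : nat)
    (f N : 'rV[R]_n -> 'rV[R]_n.+1) (U : set 'rV[R]_n)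
    (V : set 'rV[R]_2) (s : 'rV[R]_2 -> 'rV[R]_n) : Prop :=
  [/\ open V, connected V, smooth V s, (forall q, V q -> U (s q))
    & forall q, V q -> exists X Y, Delta_frame f N (s q) X Y /\
        ('J (f \o s) q == col_mx (X *m 'J f (s q)) (Y *m 'J f (s q)))%MS].

(* Sphere in the affine 3-space through c directed by the rows of E. *)
Definition sphere2 (R : realType) (n : nat) (c : 'rV[R]_n) (E : 'M[R]_(3, n))
    (r : R) : set 'rV[R]_n :=
  [set x | (x - c <= E)%MS /\ dot (x - c) (x - c) = r ^+ 2].

Definition open_part_of_2sphere (R : realType) (n : nat) (A : set 'rV[R]_n) :
    Prop :=
  exists (c : 'rV[R]_n) (E : 'M[R]_(3, n)) (r : R) (O : set 'rV[R]_n),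
    [/\ row_free E, 0 < r, open O & A = O `&` sphere2 c E r].

(* Nb is the unit normal of the patch z inside the 3-space of the sphere. *)
Definition sphere_patch (R : realType) (n : nat) (c : 'rV[R]_n)
    (E : 'M[R]_(3, n)) (r : R) (D : set 'rV[R]_2)
    (z Nb : 'rV[R]_2 -> 'rV[R]_n) : Prop :=
  [/\ row_free E, 0 < r, regular_patch D z,
      (forall q, D q -> sphere2 c E r (z q))
    & unit_normal D z Nb /\ forall q, D q -> (Nb q <= E)%MS].

Definition orthonormal_basis_of_complement (R : realType) (n k : nat)
    (E : 'M[R]_(3, n)) (e : 'M[R]_(k, n)) : Prop :=
  [/\ (k + 3)%N = n, forall i j, dot (row i e) (row j e) = (i == j)%:R
    & forall i j, dot (row i e) (row j E) = 0].

(* Row 0 of e is the constant vector called e, from which e_1 is built; for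
   i > 0, row i is e_(i+1). *)
Definition gen_frame (R : realType) (m n : nat) (e : 'M[R]_(m.+1, n))
    (alpha : R) (Nb : 'rV[R]_2 -> 'rV[R]_n) (i : 'I_m.+1) (q : 'rV[R]_2) :
    'rV[R]_n :=
  if i == 0 then - sin alpha *: Nb q + cos alpha *: row 0 e else row i e.

(* The first two parameters are (u, v), the remaining m+1 = n-2 are the w. *)
Definition generated (R : realType) (m n : nat) (e : 'M[R]_(m.+1, n))
    (alpha : R) (z Nb : 'rV[R]_2 -> 'rV[R]_n) (p : 'rV[R]_(2 + m.+1)) :
    'rV[R]_n :=
  z (lsubmx p) +
  \sum_(i < m.+1) rsubmx p 0 i *: gen_frame e alpha Nb i (lsubmx p).

Definition regular_domain (R : realType) (m n : nat) (D : set 'rV[R]_2)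
    (F : 'rV[R]_(2 + m.+1) -> 'rV[R]_n) : set 'rV[R]_(2 + m.+1) :=
  [set p | D (lsubmx p) /\ row_free ('J F p)].

(* Main.v *)
Require Import Defs.
From HB Require Import structures.
From mathcomp Require Import all_boot all_order all_algebra.
From mathcomp Require Import all_classical all_reals all_analysis.
From mathcomp Require Import ring lra.

Set Implicit Arguments.
Unset Strict Implicit.
Unset Printing Implicit Defensive.

Import Order.TTheory GRing.Theory Num.Theory.
Import numFieldNormedType.Exports.

Local Open Scope classical_set_scope.
Local Open Scope ring_scope.

(** Direct part. Let x = f o s be an integral surface of Delta and n = N o s the
    hypersurface normal along it. The shape operator S is self-adjoint with
    characteristic polynomial (X - nu)^2 X^(d-2), where d is the dimension of
    the hypersurface, so S^2 = nu S and S vanishes on the orthogonal complement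
    of Delta ([selfadj_sq], [selfadj_rank2]).
    Consequently dn = - la dx along the surface, and at all points of the
    hypersurface <N_b, N_c> = - nu <N_b, f_c> ([third_form_proportional]).
    The last identity contains only first derivatives. Differentiated along a
    nullity direction a, and combined with the symmetry of the second
    derivatives, it gives <x_uv, f_a> = mu <x_u, x_v> with mu independent of u
    and v ([nullity_second_form]). Together with <x_uv, n> = la <x_u, x_v> this
    says that the integral surface is totally umbilical in the ambient Euclidean
    space, with nowhere vanishing mean curvature vector eta.

    A connected totally umbilical surface with eta nonzero lies on a 2-sphere.
    The symmetry of the third derivatives of x forces the normal part of the
    derivative of eta to vanish ([eta_parallel]), hence
    eta_v = - |eta|^2 x_v ([dder_eta]). So kappa = |eta|^2 and
    c = x + eta / kappa are constant, and so is the orthogonal projection onto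
    the span of x_1, x_2 and eta ([oscproj_const]): the surface lies in a fixed
    affine 3-space, at distance kappa^(-1/2) from c. That its image is open in
    the sphere follows by minimizing the distance to a point y of the sphere
    close to x(p) ([nearest_point]): at the minimum x(q) the vector y - x(q) is
    orthogonal to the tangent plane of the sphere at x(q), so y is x(q) or its
    antipode, and the antipode is too far away.

    Converse. On the sphere z - c = rho Nb with rho = r or - r, hence
    d Nb = rho^(-1) dz. Therefore
    dF(v, h) = tau dz(v) + sum_i h_i e_i, where tau = 1 - w_1 sin(alpha) / rho
    depends on the parameter w_1, and F is regular exactly where tau is
    not zero ([generated_regular]). The field cos(alpha) Nb + sin(alpha) e is a unit
    normal with differential (cos(alpha) / rho) dz, so the shape operator is
    - cos(alpha) / (rho tau) on the (u, v)-plane and 0 on the rulings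
    ([generated_shape]). *)

(** * Smooth scalar functions and coordinates *)

Lemma near_eq_differentiable (R : realType) (V W : normedModType R)
    (f g : V -> W) (p : V) :
  (\near p, f p = g p) -> differentiable f p -> differentiable g p.
Proof.
move=> fg /diff_locallyP [cf ef].
have eg : g \o shift p = cst (g p) + 'd f p +o_ 0 id.
  apply/eqaddoP => e e0; move/eqaddoP : ef => /(_ e e0).
  have fg0 : \forall y \near (0 : V), f (y + p) = g (y + p).
    by have := fg; rewrite (near_shift 0); apply: filterS => y /=; rewrite subr0.
  apply: filterS2 fg0 => y fgy; move: (nbhs_singleton fg) => /= fgp.
  by rewrite /= !fctE /= -fgy -fgp.
have dgf := diff_unique cf eg.
by apply/diff_locallyP; rewrite dgf.
Qed.

(** The class C^k for real-valued functions: products, quotients and compositions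
    are treated coordinatewise, and [Ck] is recovered in [Ck_coordP]. *)
Fixpoint CkR (R : realType) (m k : nat) (U : set 'rV[R]_m)
    (f : 'rV[R]_m -> R) : Prop :=
  if k is k'.+1 then
    (forall p, U p -> differentiable f p) /\
    (forall v : 'rV[R]_m, CkR k' U (fun p => 'D_v f p))
  else forall p, U p -> {for p, continuous f}.

Definition smoothR (R : realType) (m : nat) (U : set 'rV[R]_m)
    (f : 'rV[R]_m -> R) : Prop := forall k, CkR k U f.

Section Ck.
Variables (R : realType) (m : nat) (U : set 'rV[R]_m).
Hypothesis oU : open U.
Implicit Types f g : 'rV[R]_m -> R.

Lemma near_on (T : Type) (f g : 'rV[R]_m -> T) p : U p ->
  (forall q, U q -> f q = g q) -> \near p, f p = g p.
Proof.
move=> Up fg; have : nbhs p U by exact: open_nbhs_nbhs.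
exact: filterS.
Qed.

Lemma CkR_eq k f g : (forall p, U p -> f p = g p) -> CkR k U f -> CkR k U g.
Proof.
elim: k f g => [|k IH] f g fg /=.
  move=> cf p Up; have := cf p Up.
  have nfg := near_on Up fg.
  move=> h; suff : g @ p --> f p by rewrite (fg p Up).
  apply: cvg_trans h.
  exact: (@near_eq_cvg _ _ (nbhs p) _ f g nfg).
case=> df cf; split.
  by move=> p Up; apply: near_eq_differentiable (df p Up); exact: near_on fg.
move=> v; apply: IH (cf v) => p Up.
by apply: near_eq_derive; exact: near_on fg.
Qed.

Lemma CkRW k f : CkR k.+1 U f -> CkR k U f.
Proof.
elim: k f => [|k IH] f.
  by move=> [df _] p Up; exact: differentiable_continuous (df p Up).
by move=> [df cf]; split => // v; apply: IH.
Qed.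

Lemma CkR_cst k (c : R) : CkR k U (fun=> c).
Proof.
elim: k c => [|k IH] c /=; first by move=> p _; exact: cst_continuous.
split; first by move=> p _; exact: differentiable_cst.
by move=> v; apply: CkR_eq (IH 0) => p Up; rewrite derive_cst.
Qed.

Lemma CkRD k f g : CkR k U f -> CkR k U g -> CkR k U (fun p => f p + g p).
Proof.
elim: k f g => [|k IH] f g.
  by move=> cf cg p Up; exact: (continuousD (cf p Up) (cg p Up)).
move=> [df cf] [dg cg]; split.
  by move=> p Up; apply: differentiableD; [exact: df|exact: dg].
move=> v; apply: CkR_eq (IH _ _ (cf v) (cg v)) => p Up.
by rewrite -deriveD//; apply: diff_derivable; [exact: df|exact: dg].
Qed.

Lemma CkRM k f g : CkR k U f -> CkR k U g -> CkR k U (fun p => f p * g p).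
Proof.
elim: k f g => [|k IH] f g.
  by move=> cf cg p Up; exact: (continuousM (cf p Up) (cg p Up)).
move=> Hf Hg; have [df cf] := Hf; have [dg cg] := Hg; split.
  by move=> p Up; apply: differentiableM; [exact: df|exact: dg].
move=> v; apply: CkR_eq (CkRD (IH _ _ (CkRW Hf) (cg v)) (IH _ _ (CkRW Hg) (cf v))).
by move=> p Up; rewrite -deriveM//; apply: diff_derivable; [exact: df|exact: dg].
Qed.

Lemma CkR_sum k n (f : 'I_n -> 'rV[R]_m -> R) :
  (forall i, CkR k U (f i)) -> CkR k U (fun p => \sum_i f i p).
Proof.
elim: n f => [|n IH] f Hf.
  by apply: CkR_eq (CkR_cst k 0) => p _; rewrite big_ord0.
have h := CkRD (Hf ord0) (IH (fun i => f (lift ord0 i)) (fun i => Hf _)).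
by apply: CkR_eq h => p _; rewrite big_ord_recl.
Qed.

(** By induction on k, since D(1/f) = - (1/f)^2 Df is a product of C^k
    functions. *)
Lemma CkRV k f : (forall p, U p -> f p != 0) -> CkR k U f ->
  CkR k U (fun p => (f p)^-1).
Proof.
move=> f0; elim: k => [|k IH] Hf.
  by move=> p Up; exact: (continuousV (f0 p Up) (Hf p Up)).
have [df cf] := Hf; split.
  by move=> p Up; apply: differentiableV; [exact: df|exact: f0].
move=> v; have c := IH (CkRW Hf).
apply: CkR_eq (CkRM (CkR_cst k (-1)) (CkRM (CkRM c c) (cf v))) => p Up.
rewrite deriveV ?f0//; last exact/diff_derivable/df.
by rewrite scaleNr mulN1r -invfM -expr2.
Qed.

Lemma smoothR_derive v f : smoothR U f -> smoothR U (fun p => 'D_v f p).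
Proof. by move=> sf k; have [_] := sf k.+1; apply. Qed.

Lemma smoothR_diff f p : smoothR U f -> U p -> differentiable f p.
Proof. by move=> sf; have [+ _] := sf 1%N; apply. Qed.

Lemma smoothR_deriv f p v : smoothR U f -> U p -> derivable f p v.
Proof. by move=> sf Up; apply/diff_derivable/smoothR_diff. Qed.

Lemma smoothR_cont f p : smoothR U f -> U p -> {for p, continuous f}.
Proof. by move=> sf; exact: (sf 0%N). Qed.

End Ck.

Section coords.
Variables (R : realType) (m n : nat).
Implicit Types F : 'rV[R]_m -> 'rV[R]_n.

Lemma rV_fun_sum F : F = \sum_(j < n) (fun p => F p 0 j *: (delta_mx 0 j : 'rV[R]_n)).
Proof. by apply/funext => p; rewrite fct_sumE -row_sum_delta. Qed.

Lemma differentiable_coordP F p :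
  differentiable F p <-> forall j, differentiable (fun p => F p 0 j) p.
Proof.
split=> [dF j|dF].
  exact: (differentiable_comp dF (differentiable_coord _ _ _)).
rewrite (rV_fun_sum F); apply: differentiable_sum => j.
exact: differentiableZl.
Qed.

Lemma continuous_coordP F p :
  {for p, continuous F} <-> forall j, {for p, continuous (fun p => F p 0 j)}.
Proof.
split=> [cF j|cF].
  apply: (@continuous_comp _ _ _ F (fun M : 'rV[R]_n => M 0 j) p cF).
  exact: coord_continuous.
rewrite (rV_fun_sum F).
elim/big_ind: _ => [|f g cf cg|j _]; first exact: cst_continuous.
  exact: continuousD.
apply: (@continuous_comp _ _ _ (fun p => F p 0 j) (fun r : R => r *: ('e_j : 'rV[R]_n)) p (cF j)).
exact: scalel_continuous.
Qed.

Lemma derive_coord F p v j : derivable F p v ->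
  'D_v F p 0 j = 'D_v (fun p => F p 0 j) p.
Proof. by move=> dF; rewrite derive_mx// mxE. Qed.

(** Derivatives of row-vector maps are computed entrywise, so smoothness can be
    checked on coordinates. *)
Lemma Ck_coordP (U : set 'rV[R]_m) k F : open U ->
  Ck k U F <-> forall j, CkR k U (fun p => F p 0 j).
Proof.
move=> oU; elim: k F => [|k IH] F.
  split=> [cF j p Up|cF p Up]; last by apply/continuous_coordP => j; exact: cF.
  by have /continuous_coordP := cF p Up; apply.
split=> [[dF cF] j|cF].
  split=> [p Up|v]; first by have /differentiable_coordP := dF p Up; apply.
  have /IH /(_ j) := cF v; apply: CkR_eq => // p Up.
  by rewrite derive_coord//; exact/diff_derivable/dF.
have dF p : U p -> differentiable F p.
  by move=> Up; apply/differentiable_coordP => j; have [+ _] := cF j; apply.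
split=> // v; apply/IH => j; have [_ /(_ v)] := cF j; apply: CkR_eq => // p Up.
by rewrite derive_coord//; exact/diff_derivable/dF.
Qed.

Lemma smooth_coordP (U : set 'rV[R]_m) F : open U ->
  smooth U F <-> forall j, smoothR U (fun p => F p 0 j).
Proof.
move=> oU; split=> [sF j k|sF k].
  by have /(Ck_coordP _ _ oU) := sF k; apply.
by apply/Ck_coordP => // j; exact: sF.
Qed.

End coords.

(** * Euclidean inner product and calculus of smooth maps *)

Section Dot.
Variables (R : realType) (n : nat).
Implicit Types (x y z : 'rV[R]_n) (a : R).

Lemma dotE x y : dot x y = (x *m y^T) 0 0.
Proof. by rewrite mxE; apply: eq_bigr => i _; rewrite mxE. Qed.

Lemma dotC x y : dot x y = dot y x.
Proof. by apply: eq_bigr => i _; rewrite mulrC. Qed.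

Lemma dotDl x y z : dot (x + y) z = dot x z + dot y z.
Proof. by rewrite -big_split; apply: eq_bigr => i _; rewrite mxE mulrDl. Qed.

Lemma dotZl a x y : dot (a *: x) y = a * dot x y.
Proof. by rewrite mulr_sumr; apply: eq_bigr => i _; rewrite mxE mulrA. Qed.

Lemma dotNl x y : dot (- x) y = - dot x y.
Proof. by rewrite -scaleN1r dotZl mulN1r. Qed.

Lemma dotBl x y z : dot (x - y) z = dot x z - dot y z.
Proof. by rewrite dotDl dotNl. Qed.

Lemma dotDr x y z : dot z (x + y) = dot z x + dot z y.
Proof. by rewrite !(dotC z) dotDl. Qed.

Lemma dotZr a x y : dot x (a *: y) = a * dot x y.
Proof. by rewrite !(dotC x) dotZl. Qed.

Lemma dotNr x y : dot x (- y) = - dot x y.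
Proof. by rewrite !(dotC x) dotNl. Qed.

Lemma dotBr x y z : dot z (x - y) = dot z x - dot z y.
Proof. by rewrite !(dotC z) dotBl. Qed.

Lemma dot0l x : dot 0 x = 0.
Proof. by rewrite -(scale0r 0) dotZl mul0r. Qed.

Lemma dot0r x : dot x 0 = 0.
Proof. by rewrite dotC dot0l. Qed.

Lemma dot_suml k (c : 'I_k -> R) (X : 'I_k -> 'rV[R]_n) y :
  dot (\sum_i c i *: X i) y = \sum_i c i * dot (X i) y.
Proof.
elim/big_ind2: _ => [|a b u v <- <-|i _]; first exact: dot0l.
  by rewrite dotDl.
by rewrite dotZl.
Qed.

Lemma dot_ge0 x : 0 <= dot x x.
Proof. by apply: sumr_ge0 => i _; rewrite -expr2 sqr_ge0. Qed.

Lemma dot_eq0 x : dot x x = 0 -> x = 0.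
Proof.
move=> h; apply/rowP => i; rewrite mxE; apply/eqP.
have := psumr_eq0P (fun j _ => sqr_ge0 (x 0 j)) h => /(_ i isT) /eqP.
by rewrite sqrf_eq0.
Qed.

Lemma dot_gt0 x : x != 0 -> 0 < dot x x.
Proof.
by move=> x0; rewrite lt_def dot_ge0 andbT; apply: contra_neq x0; exact: dot_eq0.
Qed.

(** Strict Cauchy-Schwarz: the Gram determinant times <y, y> is the square length
    of <y, y> x - <x, y> y, which is nonzero by independence. *)
Lemma dot_gram_gt0 x y : (forall s t, s *: x + t *: y = 0 -> s = 0 /\ t = 0) ->
  0 < dot x x * dot y y - dot x y ^+ 2.
Proof.
move=> free.
have y0 : 0 < dot y y.
  apply: dot_gt0; apply/eqP => y0; have [|_ /eqP] := free 0 1.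
    by rewrite y0 scaler0 scale0r addr0.
  by rewrite oner_eq0.
pose z := dot y y *: x + (- dot x y) *: y.
have : 0 < dot z z.
  apply: dot_gt0; apply/eqP => /free [h _]; by rewrite h ltxx in y0.
have -> : dot z z = dot y y * (dot x x * dot y y - dot x y ^+ 2).
  by rewrite /z !(dotDl, dotDr, dotZl, dotZr) (dotC y x); ring.
by rewrite pmulr_rgt0.
Qed.

End Dot.

(** The derivative of f in the direction v. It is sealed because terms such as
    [dder u f p] and [dder v f p] must be told apart by their directions, without
    unfolding the limits that define them. *)
HB.lock Definition dder (R : realType) (m : nat) (W : normedModType R)
  (v : 'rV[R]_m) (f : 'rV[R]_m -> W) : 'rV[R]_m -> W := fun p => 'D_v f p.

Section Smooth.
Variables (R : realType) (m n : nat) (U : set 'rV[R]_m).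
Hypothesis oU : open U.
Implicit Types (f g : 'rV[R]_m -> R) (F G : 'rV[R]_m -> 'rV[R]_n).

Lemma smooth_coord F j : smooth U F -> smoothR U (fun p => F p 0 j).
Proof. by move/(smooth_coordP _ oU); apply. Qed.

Lemma smooth_eq F G : (forall p, U p -> F p = G p) -> smooth U F -> smooth U G.
Proof.
move=> FG /(smooth_coordP _ oU) sF; apply/(smooth_coordP _ oU) => j k.
by apply: (CkR_eq oU _ (sF j k)) => p Up; rewrite FG.
Qed.

Lemma smoothR_eq f g : (forall p, U p -> f p = g p) -> smoothR U f -> smoothR U g.
Proof. by move=> fg sf k; exact: (CkR_eq oU fg). Qed.

Lemma smoothR_cst c : smoothR U (fun=> c : R).
Proof. by move=> k; exact: CkR_cst. Qed.

Lemma smoothR_D f g : smoothR U f -> smoothR U g -> smoothR U (fun p => f p + g p).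
Proof. by move=> sf sg k; exact: CkRD. Qed.

Lemma smoothR_M f g : smoothR U f -> smoothR U g -> smoothR U (fun p => f p * g p).
Proof. by move=> sf sg k; exact: CkRM. Qed.

Lemma smoothR_N f : smoothR U f -> smoothR U (fun p => - f p).
Proof.
move=> sf; apply: (smoothR_eq _ (smoothR_M (smoothR_cst (-1)) sf)) => p _.
by rewrite mulN1r.
Qed.

Lemma smoothR_B f g : smoothR U f -> smoothR U g -> smoothR U (fun p => f p - g p).
Proof. by move=> sf sg; apply: smoothR_D => //; exact: smoothR_N. Qed.

Lemma smoothR_V f : (forall p, U p -> f p != 0) -> smoothR U f -> smoothR U (fun p => (f p)^-1).
Proof. by move=> f0 sf k; exact: CkRV. Qed.

Lemma smoothR_proj (i : 'I_m) : smoothR U (fun p => p 0 i).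
Proof.
case=> [|k]; first by move=> p _; exact: coord_continuous.
split=> [p _|v]; first exact: differentiable_coord.
apply: (@CkR_eq _ _ U oU k (fun=> v 0 i)) => [p _|]; last exact: CkR_cst.
by rewrite -(@derive_coord _ _ _ id)// derive_id.
Qed.

Lemma smooth_cst (c : 'rV[R]_n) : smooth U (fun=> c).
Proof. by apply/(smooth_coordP _ oU) => j; exact: smoothR_cst. Qed.

Lemma smooth_sum k (F : 'I_k -> 'rV[R]_m -> 'rV[R]_n) :
  (forall i, smooth U (F i)) -> smooth U (fun p => \sum_i F i p).
Proof.
move=> sF; apply/(smooth_coordP _ oU) => j l.
have h := CkR_sum oU (fun i => smooth_coord j (sF i) l).
by apply: (CkR_eq oU _ h) => p _; rewrite summxE.
Qed.

Lemma smooth_reindex (h : 'I_n -> 'I_m) : smooth U (fun p => \row_j p 0 (h j)).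
Proof.
apply/(smooth_coordP _ oU) => j.
by apply: (smoothR_eq _ (smoothR_proj (h j))) => p _; rewrite mxE.
Qed.

Lemma smoothD F G : smooth U F -> smooth U G -> smooth U (fun p => F p + G p).
Proof.
move=> sF sG; apply/(smooth_coordP _ oU) => j.
apply: (smoothR_eq _ (smoothR_D (smooth_coord j sF) (smooth_coord j sG))) => p _.
by rewrite mxE.
Qed.

Lemma smoothZ f G : smoothR U f -> smooth U G -> smooth U (fun p => f p *: G p).
Proof.
move=> sf sG; apply/(smooth_coordP _ oU) => j.
by apply: (smoothR_eq _ (smoothR_M sf (smooth_coord j sG))) => p _; rewrite mxE.
Qed.

Lemma smoothN F : smooth U F -> smooth U (fun p => - F p).
Proof.
move=> sF; apply: (smooth_eq _ (smoothZ (smoothR_cst (-1)) sF)) => p _.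
by rewrite scaleN1r.
Qed.

Lemma smoothB F G : smooth U F -> smooth U G -> smooth U (fun p => F p - G p).
Proof. by move=> sF sG; apply: smoothD => //; exact: smoothN. Qed.

Lemma smoothR_dot F G : smooth U F -> smooth U G -> smoothR U (fun p => dot (F p) (G p)).
Proof.
move=> sF sG k; apply: CkR_sum => // i; apply: CkRM => //; exact: smooth_coord.
Qed.

Lemma smooth_diff F p : smooth U F -> U p -> differentiable F p.
Proof. by move=> sF; have [+ _] := sF 1%N; apply. Qed.

Lemma smooth_deriv F p v : smooth U F -> U p -> derivable F p v.
Proof. by move=> sF Up; apply/diff_derivable/smooth_diff. Qed.

Lemma smooth_dder v F : smooth U F -> smooth U (dder v F).
Proof. by rewrite dder.unlock => sF k; have [_] := sF k.+1; apply. Qed.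

Lemma dder_on (W : normedModType R) (f g : 'rV[R]_m -> W) p v : U p ->
  (forall q, U q -> f q = g q) -> dder v f p = dder v g p.
Proof.
by rewrite dder.unlock => Up fg; apply: near_eq_derive; exact: near_on Up fg.
Qed.

Lemma dder_proj (p v : 'rV[R]_m) (i : 'I_m) : dder v (fun p => p 0 i) p = v 0 i.
Proof. by rewrite dder.unlock -(@derive_coord _ _ _ id)// derive_id. Qed.

Lemma dder_coord F p v j : smooth U F -> U p ->
  dder v F p 0 j = dder v (fun p => F p 0 j) p.
Proof.
by rewrite dder.unlock => sF Up; apply: derive_coord; exact: smooth_deriv.
Qed.

Lemma dderD F G p v : smooth U F -> smooth U G -> U p ->
  dder v (fun p => F p + G p) p = dder v F p + dder v G p.
Proof.
by rewrite dder.unlock => sF sG Up; apply: deriveD; exact: smooth_deriv.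
Qed.

Lemma dderB F G p v : smooth U F -> smooth U G -> U p ->
  dder v (fun p => F p - G p) p = dder v F p - dder v G p.
Proof.
by rewrite dder.unlock => sF sG Up; apply: deriveB; exact: smooth_deriv.
Qed.

Lemma dder_sum k (F : 'I_k -> 'rV[R]_m -> 'rV[R]_n) p v :
  (forall i, smooth U (F i)) -> U p ->
  dder v (fun p => \sum_i F i p) p = \sum_i dder v (F i) p.
Proof.
rewrite dder.unlock => sF Up.
have -> : (fun p => \sum_i F i p) = \sum_i F i.
  by apply/funext => q; rewrite fct_sumE.
by rewrite derive_sum// => i; exact: smooth_deriv.
Qed.

Lemma dder_cst (W : normedModType R) (c : W) (p v : 'rV[R]_m) :
  dder v (fun=> c) p = 0.
Proof. by rewrite dder.unlock derive_cst. Qed.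

Lemma dderM f g p v : smoothR U f -> smoothR U g -> U p ->
  dder v (fun p => f p * g p) p = dder v f p * g p + f p * dder v g p.
Proof.
rewrite dder.unlock => sF sG Up; rewrite [LHS]deriveM; [|exact: smoothR_deriv..].
by rewrite addrC; congr (_ + _); rewrite mulrC.
Qed.

Lemma dderZ f G p v : smoothR U f -> smooth U G -> U p ->
  dder v (fun p => f p *: G p) p = dder v f p *: G p + f p *: dder v G p.
Proof.
move=> sf sG Up; apply/rowP => j; rewrite (dder_coord _ _ (smoothZ sf sG) Up).
have -> : (fun q => (f q *: G q) 0 j) = (fun q => f q * G q 0 j).
  by apply/funext => q; rewrite mxE.
by rewrite !mxE (dderM _ sf (smooth_coord j sG) Up) (dder_coord _ _ sG Up).
Qed.

Lemma dder_dot F G p v : smooth U F -> smooth U G -> U p ->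
  dder v (fun p => dot (F p) (G p)) p = dot (dder v F p) (G p) + dot (F p) (dder v G p).
Proof.
move=> sF sG Up.
have -> : (fun p => dot (F p) (G p)) =
    \sum_(i < n) (fun p => F p 0 i * G p 0 i).
  by apply/funext => q; rewrite fct_sumE.
have sFG i : smoothR U (fun p => F p 0 i * G p 0 i).
  by apply: smoothR_M; exact: smooth_coord.
have -> : dder v (\sum_(i < n) (fun p => F p 0 i * G p 0 i)) p =
    \sum_(i < n) dder v (fun p => F p 0 i * G p 0 i) p.
  by rewrite dder.unlock derive_sum// => i; exact: smoothR_deriv.
rewrite -big_split; apply: eq_bigr => i _ /=.
rewrite (dderM _ (smooth_coord i sF) (smooth_coord i sG) Up).
by rewrite (dder_coord _ _ sF Up) (dder_coord _ _ sG Up).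
Qed.

Lemma dder_dotc F (c : 'rV[R]_n) p v : smooth U F -> U p ->
  dder v (fun p => dot (F p) c) p = dot (dder v F p) c.
Proof.
move=> sF Up; rewrite (dder_dot v sF (smooth_cst c) Up).
by rewrite dder_cst dot0r addr0.
Qed.

Lemma dderE F p v : smooth U F -> U p -> dder v F p = v *m 'J F p.
Proof.
by rewrite dder.unlock => sF Up; apply: deriveEjacobian; exact: smooth_diff.
Qed.

End Smooth.

Section Composition.
Variables (R : realType) (m n : nat) (V : set 'rV[R]_m) (U : set 'rV[R]_n).
Hypotheses (oV : open V) (oU : open U).
Variable s : 'rV[R]_m -> 'rV[R]_n.
Hypotheses (ss : smooth V s) (sVU : forall q, V q -> U (s q)).

Lemma dder_comp (W : normedModType R) (f : 'rV[R]_n -> W) q v :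
  V q -> differentiable f (s q) ->
  dder v (fun q => f (s q)) q = dder (dder v s q) f (s q).
Proof.
rewrite dder.unlock => Vq df.
have ds : differentiable s q := smooth_diff ss Vq.
rewrite [LHS]deriveE; last exact: (differentiable_comp ds df).
rewrite (_ : (fun q => f (s q)) = f \o s)// diff_comp//=.
by rewrite deriveE// [in RHS]deriveE.
Qed.

Lemma dder_basis (W : normedModType R) (f : 'rV[R]_n -> W) p (v : 'rV[R]_n) :
  differentiable f p -> dder v f p = \sum_i v 0 i *: dder 'e_i f p.
Proof.
rewrite dder.unlock => df; rewrite deriveE// [in LHS](row_sum_delta v) linear_sum.
by apply: eq_bigr => i _; rewrite linearZ -deriveE.
Qed.

(** The chain rule writes D_v(f o s) as the sum of (D_v s)_i times
    (D_i f) o s, to which the induction hypothesis applies. *)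
Lemma CkR_comp k f : CkR k U f -> CkR k V (fun q => f (s q)).
Proof.
elim: k f => [|k IH] f.
  move=> cf q Vq; apply: (@continuous_comp _ _ _ s f q).
    exact/differentiable_continuous/(smooth_diff ss Vq).
  exact/cf/sVU.
move=> [df cf]; split.
  move=> q Vq; apply: (differentiable_comp (smooth_diff ss Vq)).
  exact/df/sVU.
move=> v.
have h : CkR k V (fun q => \sum_i dder v s q 0 i * dder 'e_i f (s q)).
  apply: CkR_sum => // i; apply: CkRM => //.
    exact: (smooth_coord oV i (smooth_dder v ss)).
  by apply: (IH (dder 'e_i f)); rewrite dder.unlock; exact: cf.
apply: (CkR_eq oV _ h) => q Vq.
have dfq : differentiable f (s q) by exact/df/sVU.
by rewrite -(dder_basis _ dfq) -(dder_comp _ Vq dfq) dder.unlock.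
Qed.

Lemma smoothR_comp f : smoothR U f -> smoothR V (fun q => f (s q)).
Proof. by move=> sf k; exact: CkR_comp. Qed.

Lemma smooth_comp l (F : 'rV[R]_n -> 'rV[R]_l) :
  smooth U F -> smooth V (fun q => F (s q)).
Proof.
move=> sF; apply/(smooth_coordP _ oV) => j.
exact: smoothR_comp (smooth_coord oU j sF).
Qed.

End Composition.

(** * Symmetry of second derivatives, constancy and interior minima *)

Lemma dist_via (R : realType) (a b c e : R) :
  `|c - a| < e / 2 -> `|c - b| < e / 2 -> `|a - b| <= e.
Proof.
move=> b1 b2; have -> : a - b = - (c - a) + (c - b) by ring.
rewrite (le_trans (ler_normD _ _))// normrN [leRHS]splitr.
by rewrite lerD// ltW.
Qed.

Section Line.
Variables (R : realType) (V W : normedModType R).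
Implicit Types (f : V -> W) (q u : V) (t : R).

(** Restricting f to a line turns a directional derivative into an ordinary one:
    the two difference quotients are the same function. *)
Lemma line_quotient f q u t :
  (fun h : R => h^-1 *: (((fun t => f (q + t *: u)) \o shift t) (h *: 1)
     - f (q + t *: u))) =
  (fun h : R => h^-1 *: ((f \o shift (q + t *: u)) (h *: u) - f (q + t *: u))).
Proof.
apply/funext => h /=; congr (_ *: (f _ - _)).
by rewrite [_%:A]mulr1 scalerDl addrCA.
Qed.

Lemma is_derive_line f q u t : differentiable f (q + t *: u) ->
  is_derive t 1 (fun t => f (q + t *: u)) ('D_u f (q + t *: u)).
Proof.
move=> df0; have df : derivable f (q + t *: u) u by exact: diff_derivable.
apply: DeriveDef.
  by rewrite /derivable line_quotient.
by rewrite /derive line_quotient.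
Qed.

End Line.

Section Analysis.
Variables (R : realType) (m : nat).
Implicit Types (f : 'rV[R]_m -> R) (p q u v : 'rV[R]_m) (U V : set 'rV[R]_m).

Lemma mvt_line f q u (h : R) : 0 < h ->
  (forall t, t \in `[0, h]%R -> differentiable f (q + t *: u)) ->
  exists2 c, c \in `]0, h[%R & f (q + h *: u) - f q = h * 'D_u f (q + c *: u).
Proof.
move=> h0 df.
have dl (t : R) : t \in `[0, h]%R ->
    is_derive t 1 (fun t => f (q + t *: u)) ('D_u f (q + t *: u)).
  by move=> /df; exact: is_derive_line.
have cl : {within `[0, h], continuous (fun t => f (q + t *: u))}.
  by apply: derivable_within_continuous => t th; have [] := dl t th.
have dlo (t : R) : t \in `]0, h[%R ->
    is_derive t 1 (fun t => f (q + t *: u)) ('D_u f (q + t *: u)).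
  by move=> th; apply: dl; move: th; rewrite !in_itv/= => /andP[/ltW-> /ltW].
have [c ch e] := MVT h0 dlo cl.
by exists c => //; move: e; rewrite scale0r addr0 subr0 mulrC.
Qed.

(** The mean value theorem applied twice: first to t |-> g (p + t u), where
    g q = f (q + h v) - f q, then to the u-derivative of f along v. *)
Lemma second_difference U f p u v (h : R) : open U -> smoothR U f -> 0 < h ->
  (forall s t : R, s \in `[0, h]%R -> t \in `[0, h]%R -> U (p + s *: u + t *: v)) ->
  exists s t, [/\ s \in `[0, h]%R, t \in `[0, h]%R &
    f (p + h *: u + h *: v) - f (p + h *: u) - f (p + h *: v) + f p =
    h ^+ 2 * 'D_v (fun q => 'D_u f q) (p + s *: u + t *: v)].
Proof.
move=> oU sf h0 Uh.
have h0in : 0 \in `[0, h]%R by rewrite in_itv/= lexx ltW.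
have hhin : h \in `[0, h]%R by rewrite in_itv/= lexx ltW.
have o2c (t : R) : t \in `]0, h[%R -> t \in `[0, h]%R.
  by rewrite !in_itv/= => /andP[/ltW-> /ltW].
pose g q := f (q + h *: v) - f q.
have dsh q (w : 'rV[R]_m) : U (q + w) ->
    is_diff q (fun q => f (q + w)) ('d f (q + w)).
  move=> Uq; have dfq : differentiable f (q + w) by apply: (smoothR_diff sf).
  have dt : is_diff q (fun q => q + w) id.
    apply: (@is_diff_eq _ _ _ (fun q => q + w) (id + 0) id).
    by rewrite addr0.
  have := @is_diff_comp _ _ _ _ (fun q => q + w) id f ('d f (q + w)) q dt
     (differentiableP dfq).
  by [].
have dg (s : R) : s \in `[0, h]%R -> is_diff (p + s *: u) g
    (fun w => 'd f (p + s *: u + h *: v) w - 'd f (p + s *: u) w).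
  move=> sh.
  have U1 := Uh s h sh hhin.
  have U0 : U (p + s *: u) by have := Uh s 0 sh h0in; rewrite scale0r addr0.
  have d1 := dsh _ _ U1.
  have d2 : is_diff (p + s *: u) f ('d f (p + s *: u)).
    by apply/differentiableP/(smoothR_diff sf).
  exact: (is_diffB d1 d2).
have dg' (s : R) : s \in `[0, h]%R -> differentiable g (p + s *: u).
  by move=> /dg [].
have [s s0 es] := mvt_line h0 dg'.
have sh := o2c _ s0.
have du (t : R) : t \in `[0, h]%R ->
    differentiable (fun q => 'D_u f q) (p + s *: u + t *: v).
  by move=> th; apply: (smoothR_diff (smoothR_derive u sf)); exact: Uh.
have [t t0 et] := mvt_line h0 du.
exists s, t; split; [exact: sh|exact: o2c|].
have -> : f (p + h *: u + h *: v) - f (p + h *: u) - f (p + h *: v) + f p =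
  g (p + h *: u) - g p by rewrite /g; ring.
rewrite es expr2 -mulrA -et; congr (_ * _).
have [dgs ds] := dg s sh.
have U1 := Uh s h sh hhin.
have U0 : U (p + s *: u) by have := Uh s 0 sh h0in; rewrite scale0r addr0.
rewrite deriveE// ds [in RHS]deriveE; last exact: (smoothR_diff sf).
by rewrite [in RHS]deriveE; last exact: (smoothR_diff sf).
Qed.

Lemma open_ball U p : open U -> U p ->
  exists2 e : R, 0 < e & forall q, `|q - p| < e -> U q.
Proof.
move=> oU Up; have /nbhs_ballP[e /= e0 He] : nbhs p U by exact: open_nbhs_nbhs.
by exists e => // q qp; apply: He; rewrite -ball_normE /= distrC.
Qed.

Lemma continuous_ball f p (e : R) : {for p, continuous f} -> 0 < e ->
  exists2 d : R, 0 < d & forall q, `|q - p| < d -> `|f q - f p| < e.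
Proof.
move=> /cvgrPdist_lt /(_ e) cf e0; have /nbhs_ballP[d /= d0 Hd] := cf e0.
exists d => // q qp; rewrite distrC; apply: Hd.
by rewrite -ball_normE /= distrC.
Qed.

(** The second difference of f is symmetric in u and v. By [second_difference] it
    is h^2 times a value of D_v D_u f and also h^2 times a value of D_u D_v f, at
    points that tend to p with h. *)
Lemma Schwarz U f p u v : open U -> smoothR U f -> U p ->
  'D_u (fun q => 'D_v f q) p = 'D_v (fun q => 'D_u f q) p.
Proof.
move=> oU sf Up; apply/eqP; rewrite -subr_eq0 -normr_le0.
apply/ler_addgt0Pl => e e0; rewrite addr0.
have e20 : 0 < e / 2 by rewrite divr_gt0.
have [d0 d00 Hd0] := open_ball oU Up.
have [d1 d10 Hd1] := continuous_ball (smoothR_cont (smoothR_derive u (smoothR_derive v sf)) Up) e20.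
have [d2 d20 Hd2] := continuous_ball (smoothR_cont (smoothR_derive v (smoothR_derive u sf)) Up) e20.
pose d := Num.min d0 (Num.min d1 d2).
have dgt0 : 0 < d by rewrite !lt_min d00 d10.
pose k := `|u| + `|v| + 1.
have k0 : 0 < k by rewrite ltr_wpDl// addr_ge0.
(* Every point p + s u + t v with s and t in [0, h] is then at distance at most
   h k = d / 2 from p. *)
pose h := d / (k + k).
have kk0 : 0 < k + k by rewrite addr_gt0.
have h0 : 0 < h by rewrite divr_gt0.
have near (s t : R) x y : s \in `[0, h]%R -> t \in `[0, h]%R ->
    `|x| + `|y| <= k -> `|p + s *: x + t *: y - p| < d.
  rewrite !in_itv/= => /andP[s0 sh] /andP[t0 th] xy.
  rewrite -(addrA p) [p + _]addrC addrK.
  have h1 : `|s *: x + t *: y| <= h * (`|x| + `|y|).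
    apply: le_trans (ler_normD _ _) _; rewrite !normrZ !ger0_norm// mulrDr.
    by apply: lerD; exact: ler_wpM2r.
  apply: le_lt_trans h1 _; apply: (@le_lt_trans _ _ (h * k)).
    by rewrite ler_wpM2l// ltW.
  by rewrite /h -mulrA gtr_pMr// ltr_pdivrMl// mulr1 ltrDl.
have uv : `|u| + `|v| <= k by rewrite lerDl.
have vu : `|v| + `|u| <= k by rewrite [leLHS]addrC.
have H1 (s t : R) : s \in `[0, h]%R -> t \in `[0, h]%R -> U (p + s *: u + t *: v).
  move=> sh th; apply: Hd0; apply: lt_le_trans (near _ _ _ _ sh th uv) _.
  by rewrite ge_min lexx.
have H2 (s t : R) : s \in `[0, h]%R -> t \in `[0, h]%R -> U (p + s *: v + t *: u).
  move=> sh th; apply: Hd0; apply: lt_le_trans (near _ _ _ _ sh th vu) _.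
  by rewrite ge_min lexx.
have [s [t [sh th est]]] := second_difference oU sf h0 H1.
have [s' [t' [sh' th' est']]] := second_difference oU sf h0 H2.
have /(mulfI (lt0r_neq0 (exprn_gt0 2 h0))) E :
    h ^+ 2 * 'D_v (fun q => 'D_u f q) (p + s *: u + t *: v) =
    h ^+ 2 * 'D_u (fun q => 'D_v f q) (p + s' *: v + t' *: u).
  apply: etrans (esym est) (etrans _ est').
  by rewrite (addrAC p (h *: v)); congr (_ + _); rewrite [LHS]addrAC.
have near1 : `|p + s' *: v + t' *: u - p| < d1.
  apply: lt_le_trans (near _ _ _ _ sh' th' vu) _.
  by rewrite !ge_min lexx orbT.
have near2 : `|p + s *: u + t *: v - p| < d2.
  apply: lt_le_trans (near _ _ _ _ sh th uv) _.
  by rewrite !ge_min lexx !orbT.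
have b2 := Hd2 _ near2; rewrite E in b2.
exact: (dist_via (Hd1 _ near1) b2).
Qed.

Lemma locally_constant_ball f p (e : R) :
  (forall q, `|q - p| < e -> differentiable f q /\ forall v, 'D_v f q = 0) ->
  forall q, `|q - p| < e -> f q = f p.
Proof.
move=> df q qp.
have near (t : R) : t \in `[0, 1]%R -> `|p + t *: (q - p) - p| < e.
  rewrite in_itv/= => /andP[t0 t1].
  rewrite addrAC subrr add0r normrZ ger0_norm//.
  by apply: le_lt_trans qp; rewrite ler_piMl.
have df' (t : R) : t \in `[0, 1]%R -> differentiable f (p + t *: (q - p)).
  by move=> /near /df[].
have [c c01] := mvt_line ltr01 df'.
rewrite scale1r [p + _]addrC subrK (df _ _).2.
  by move/eqP; rewrite mulr0 subr_eq0 => /eqP.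
by apply: near; move: c01; rewrite !in_itv/= => /andP[/ltW-> /ltW].
Qed.

(** A level set of f in V is open, and so is its complement in V, because f is
    constant on balls. *)
Lemma locally_constant f V : open V -> connected V ->
  (forall q, V q -> differentiable f q /\ forall v, dder v f q = 0) ->
  forall p q, V p -> V q -> f q = f p.
Proof.
rewrite dder.unlock => oV cV df p q Vp Vq.
have loc y : V y -> exists2 e : R, 0 < e &
    forall z, `|z - y| < e -> V z /\ f z = f y.
  move=> Vy; have [e e0 He] := open_ball oV Vy; exists e => // z zy.
  split; first exact: He.
  by apply: (locally_constant_ball _ zy) => w wy; apply/df/He.
have oP (P : R -> Prop) : open [set y | V y /\ P (f y)].
  rewrite openE => y [Vy Py]; have [e e0 He] := loc y Vy.
  apply/nbhs_ballP; exists e => //= z; rewrite -ball_normE /= distrC.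
  by move=> /He[Vz fz]; split => //; rewrite fz.
have E : [set y | V y /\ f y = f p] = V.
  apply: cV; first by exists p.
    exists [set y | V y /\ f y = f p]; first exact: (oP (fun x => x = f p)).
    by apply/seteqP; split => y /=; [move=> []|move=> []].
  exists (~` [set y | V y /\ f y <> f p]).
    by apply: open_closedC; exact: (oP (fun x => x <> f p)).
  apply/seteqP; split => y /=; first by move=> [Vy fy]; split => // -[].
  move=> [Vy nfy]; split => //; apply: contrapT => fy; exact: nfy.
by have : V q by []; rewrite -E => -[].
Qed.

Lemma locally_constantV n (F : 'rV[R]_m -> 'rV[R]_n) V :
  open V -> connected V -> smooth V F ->
  (forall q v, V q -> dder v F q = 0) ->
  forall p q, V p -> V q -> F q = F p.
Proof.
move=> oV cV sF dF p q Vp Vq; apply/rowP => j.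
apply: (locally_constant oV cV (f := fun q => F q 0 j)) => // z Vz.
split; first exact: (smoothR_diff (smooth_coord oV j sF)).
by move=> v; have := dder_coord v j sF Vz; rewrite dF// mxE => <-.
Qed.

(** Fermat's rule on the line through p in the direction v. *)
Lemma interior_min V f p v : open V -> smoothR V f -> V p ->
  (\forall q \near p, f p <= f q) -> dder v f p = 0.
Proof.
move=> oV sf Vp fmin.
have [e e0 He] : exists2 e : R, 0 < e &
    forall q, `|q - p| < e -> V q /\ f p <= f q.
  have /nbhs_ballP[e1 /= e10 He1] := fmin.
  have [e2 e20 He2] := open_ball oV Vp.
  exists (Num.min e1 e2); first by rewrite lt_min e10.
  move=> q; rewrite lt_min => /andP[q1 q2]; split; first exact: He2.
  by apply: He1; rewrite -ball_normE /= distrC.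
pose k := `|v| + 1.
have k0 : 0 < k by rewrite ltr_wpDl.
pose h := e / k.
have h0 : 0 < h by rewrite divr_gt0.
have near (t : R) : t \in `]-h, h[%R -> `|p + t *: v - p| < e.
  rewrite in_itv/= -ltr_norml => th.
  rewrite addrAC subrr add0r normrZ.
  apply: (@le_lt_trans _ _ (`|t| * k)); first by rewrite ler_wpM2l// lerDl.
  by rewrite -ltr_pdivlMr.
have dl (t : R) : t \in `]-h, h[%R ->
    is_derive t 1 (fun t => f (p + t *: v)) ('D_v f (p + t *: v)).
  move=> /near /He[Vq _]; apply: is_derive_line; exact: (smoothR_diff sf).
have z0 : 0 \in `]-h, h[%R by rewrite in_itv/= oppr_lt0 h0.
have hh : - h <= h by rewrite ge0_cp// ltW.
have dm : is_derive (0 : R) 1 (fun t : R => f (p + t *: v)) 0.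
  apply: (derive1_at_min hh) => //; first by move=> t /dl[].
  by move=> t /near /He[_]; rewrite scale0r addr0.
have [_ <-] := dm; have [_] := dl 0 z0.
by rewrite dder.unlock scale0r addr0 => <-.
Qed.

End Analysis.

(** * Nearest points on immersed patches *)

Section Immersion.
Variables (R : realType) (m n : nat) (V : set 'rV[R]_m).
Variable x : 'rV[R]_m -> 'rV[R]_n.
Hypotheses (oV : open V) (sx : smooth V x).

Lemma dder_swap p u v : V p -> dder u (dder v x) p = dder v (dder u x) p.
Proof.
move=> Vp; apply/rowP => j.
have S w w' : dder w (dder w' x) p 0 j = dder w (dder w' (fun q => x q 0 j)) p.
  rewrite (dder_coord w j (smooth_dder w' sx) Vp).
  by apply: (dder_on oV) => // q Vq; exact: dder_coord sx Vq.
apply: etrans (S u v) (etrans _ (esym (S v u))).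
by rewrite dder.unlock; exact: (Schwarz u v oV (smooth_coord oV j sx) Vp).
Qed.

Hypothesis imm : forall q v, V q -> dder v x q = 0 -> v = 0.

(** Composing x with a left inverse of its differential at p gives a map g with
    differential the identity, so |g q - g p - (q - p)| <= |q - p| / 2 near p;
    hence g q = g p only for q = p. *)
Lemma immersion_locally_injective p : V p ->
  exists2 e : R, 0 < e & forall q, `|q - p| < e -> x q = x p -> q = p.
Proof.
move=> Vp.
have Jfree : row_free ('J x p).
  by apply: inj_row_free => v; rewrite -(dderE v sx Vp); exact: imm.
pose B := pinvmx ('J x p).
pose g q := \row_j dot (x q) (col j B)^T.
have gE j : (fun q => g q 0 j) = (fun q => dot (x q) (col j B)^T).
  by apply/funext => q; rewrite mxE.
have sg : smooth V g.
  apply/(smooth_coordP _ oV) => j; rewrite gE.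
  by apply: (smoothR_dot oV sx); exact: smooth_cst.
have dg : differentiable g p := smooth_diff sg Vp.
have dgE v : 'd g p v = v.
  have <- : dder v g p = 'd g p v by rewrite dder.unlock deriveE.
  have -> : dder v g p = dder v x p *m B.
    apply/rowP => j; rewrite (dder_coord v j sg Vp) gE.
    rewrite (dder_dotc oV _ _ sx Vp) mxE; apply: eq_bigr => i _.
    by rewrite !mxE.
  by rewrite (dderE v sx Vp) -mulmxA mulmxVp// mulmx1.
have half0 : 0 < 2^-1 :> R by rewrite invr_gt0.
have /eqaddoP /(_ _ half0) /nbhs_ballP[e /= e0 He] := diff_locally dg.
exists e => // q qp xqp.
have /He : ball 0 e (q - p) by rewrite -ball_normE /= sub0r normrN.
rewrite !fctE /= dgE subrK.
have -> : g q = g p by apply/rowP => j; rewrite !mxE xqp.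
rewrite opprD addrA subrr add0r normrN => h.
apply/eqP; rewrite -subr_eq0 -normr_le0.
by move: h; lra.
Qed.

(** This replaces the inverse function theorem. The distance from y to x is
    minimized over a small closed ball around p. On the boundary sphere x stays
    away from x p, by [immersion_locally_injective] and compactness; so for y
    close to x p the minimum is interior, and there y - x q is normal. *)
Lemma nearest_point p : V p -> exists2 d : R, 0 < d &
  forall y, dot (y - x p) (y - x p) < d ->
  exists q, [/\ V q, dot (y - x q) (y - x q) <= dot (y - x p) (y - x p) &
    forall v, dot (dder v x q) (y - x q) = 0].
Proof.
move=> Vp.
have [e1 e10 He1] := immersion_locally_injective Vp.
have [e2 e20 He2] := open_ball oV Vp.
pose e := Num.min e1 e2 / 2.
have e0 : 0 < e by rewrite divr_gt0// lt_min e10.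
have e_orthonormal : e < Num.min e1 e2.
  by rewrite ltr_pdivrMr// mulr_natr mulr2n ltrDl lt_min e10.
have [ee1 ee2] : e < e1 /\ e < e2 by apply/andP; rewrite -lt_min.
have cnorm : continuous (fun q : 'rV[R]_m => `|q - p|).
  move=> q; apply: (@continuous_comp _ _ _ (fun q : 'rV[R]_m => q - p) (fun y => `|y|)).
    by apply: continuousB => //; exact: cst_continuous.
  exact: norm_continuous.
have bnd (A : set 'rV[R]_m) : (forall q, A q -> `|q - p| <= e) -> bounded_set A.
  move=> Ae; exists (`|p| + e); split; first exact: num_real.
  move=> M HM q /Ae qp; apply: le_trans (ltW HM).
  by rewrite -[q](subrK p) addrC (le_trans (ler_normD _ _))// lerD2l.
have cK : compact [set q | `|q - p| <= e].
  apply: bounded_closed_compact; first exact: bnd.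
  exact: (preimage_closed (D := [set z | z <= e]) (fun q _ => cnorm q) (@closed_le R e)).
have cS : compact [set q | `|q - p| = e].
  apply: bounded_closed_compact; first by apply: bnd => q /= ->.
  exact: (preimage_closed (D := [set z | z = e]) (fun q _ => cnorm q) (@closed_eq R e)).
have KV q : `|q - p| <= e -> V q by move=> /le_lt_trans /(_ ee2) /He2.
have sphi y : smoothR V (fun q => dot (y - x q) (y - x q)).
  have syx : smooth V (fun q => y - x q).
    by apply: smoothB => //; exact: smooth_cst.
  exact: smoothR_dot.
have cphi y (A : set 'rV[R]_m) : (forall q, A q -> `|q - p| <= e) ->
    {within A, continuous (fun q => dot (y - x q) (y - x q))}.
  move=> Ae; apply: continuous_in_subspaceT => q /set_mem /Ae /KV Vq.
  exact: (smoothR_cont (sphi y)).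
have [d d0 Hd] : exists2 d : R, 0 < d &
    forall q, `|q - p| = e -> d <= dot (x p - x q) (x p - x q).
  have [S0|/set0P/negP/negPn/eqP S0] := pselect ([set q | `|q - p| = e] !=set0);
    last first.
    exists 1 => // q qe; have : [set q | `|q - p| = e] q by [].
    by rewrite S0.
  have eS q : [set q | `|q - p| = e] q -> `|q - p| <= e by move=> /= ->.
  have [q /set_mem qe qmin] := EVT_min_rV S0 cS (cphi (x p) _ eS).
  exists (dot (x p - x q) (x p - x q)).
    apply: dot_gt0; rewrite subr_eq0; apply/eqP => pq.
    have qp : q = p by apply: He1 => //; rewrite qe.
    by move: e0; rewrite -qe qp subrr normr0 ltxx.
  by move=> r re; apply: qmin; apply/mem_set.
(* |x q - x p|^2 <= 2 |y - x q|^2 + 2 |y - x p|^2 < 4 (d / 4) for a minimum q on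
   the boundary. *)
exists (d / 4); first by rewrite divr_gt0.
move=> y yd.
have K0 : [set q | `|q - p| <= e] !=set0.
  by exists p; rewrite /= subrr normr0 ltW.
have [q /set_mem qe qmin] := EVT_min_rV K0 cK (cphi y _ (fun q h => h)).
have qp : dot (y - x q) (y - x q) <= dot (y - x p) (y - x p).
  by apply: qmin; apply/mem_set; rewrite /= subrr normr0 ltW.
exists q; split => //; first exact: KV.
have qi : `|q - p| < e.
  rewrite lt_neqAle qe andbT; apply/eqP => /Hd.
  have -> : x p - x q = (y - x q) - (y - x p) by rewrite opprB [RHS]addrC subrKA.
  move: (y - x q) (y - x p) qp yd => s t qp yd.
  have := dot_ge0 (s + t).
  rewrite !(dotDl, dotDr, dotNl, dotNr) !(dotC t s) => h1 h2; lra.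
have Vq := KV _ qe.
move=> v; have : dder v (fun q => dot (y - x q) (y - x q)) q = 0.
  apply: (interior_min v oV (sphi y) Vq).
  apply/nbhs_ballP; exists (e - `|q - p|); first by rewrite /= subr_gt0.
  move=> r; rewrite -ball_normE /= => qr; apply: qmin; apply/mem_set => /=.
  rewrite -[r](subrK q) -addrA (le_trans (ler_normD _ _))// -lerBrDr ltW//.
  by rewrite distrC.
have syx : smooth V (fun q => y - x q).
  by apply: smoothB => //; exact: smooth_cst.
rewrite (dder_dot oV v syx syx Vq).
have -> : dder v (fun q => y - x q) q = - dder v x q.
  by rewrite (dderB v (smooth_cst oV y) sx Vq) dder_cst sub0r.
rewrite dotNr dotNl (dotC (y - x q)); lra.
Qed.

End Immersion.

(** * Totally umbilical surfaces *)

Section PlaneProjection.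
Variables (R : realType) (n : nat).
Implicit Types a b y w : 'rV[R]_n.

Definition gram2 a b : R := dot a a * dot b b - dot a b ^+ 2.

(** By Cramer's rule [coef1] and [coef2] are the coordinates in the basis (a, b) of
    the orthogonal projection [tproj] onto the plane of a and b. *)
Definition coef1 a b y : R := (dot b b * dot y a - dot a b * dot y b) / gram2 a b.

Definition coef2 a b y : R := (dot a a * dot y b - dot a b * dot y a) / gram2 a b.

Definition tproj a b y := coef1 a b y *: a + coef2 a b y *: b.

Lemma tproj1 a b y : gram2 a b != 0 -> dot (tproj a b y) a = dot y a.
Proof.
move=> g0; rewrite dotDl !dotZl (dotC b a) /coef1 /coef2.
by move: g0; rewrite /gram2 => g0; field.
Qed.

Lemma tproj2 a b y : gram2 a b != 0 -> dot (tproj a b y) b = dot y b.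
Proof.
move=> g0; rewrite dotDl !dotZl /coef1 /coef2.
by move: g0; rewrite /gram2 => g0; field.
Qed.

Lemma dot_comb_eq0 (s t : R) a b w : dot a w = 0 -> dot b w = 0 ->
  dot (s *: a + t *: b) w = 0.
Proof. by move=> aw bw; rewrite dotDl !dotZl aw bw !mulr0 addr0. Qed.

Lemma tproj_perp a b y w : dot a w = 0 -> dot b w = 0 -> dot (tproj a b y) w = 0.
Proof. exact: dot_comb_eq0. Qed.

Lemma tproj_eq0 a b y : dot y a = 0 -> dot y b = 0 -> tproj a b y = 0.
Proof.
move=> ya yb; rewrite /tproj /coef1 /coef2 ya yb !mulr0 subr0 !mul0r.
by rewrite !scale0r addr0.
Qed.

Section smooth.
Variables (m : nat) (V : set 'rV[R]_m) (A B Y : 'rV[R]_m -> 'rV[R]_n).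
Hypotheses (oV : open V) (sA : smooth V A) (sB : smooth V B) (sY : smooth V Y).
Hypothesis g0 : forall q, V q -> gram2 (A q) (B q) != 0.

Lemma smoothR_gramV : smoothR V (fun q => (gram2 (A q) (B q))^-1).
Proof.
apply: smoothR_V => //; rewrite /gram2.
apply: smoothR_B => //.
  by apply: smoothR_M => //; exact: smoothR_dot.
have h := smoothR_dot oV sA sB.
by apply: (smoothR_eq oV _ (smoothR_M oV h h)) => q _; rewrite expr2.
Qed.

Lemma smoothR_coef1 : smoothR V (fun q => coef1 (A q) (B q) (Y q)).
Proof.
apply: smoothR_M => //; last exact: smoothR_gramV.
by apply: smoothR_B => //; apply: smoothR_M => //; exact: smoothR_dot.
Qed.

Lemma smoothR_coef2 : smoothR V (fun q => coef2 (A q) (B q) (Y q)).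
Proof.
apply: smoothR_M => //; last exact: smoothR_gramV.
by apply: smoothR_B => //; apply: smoothR_M => //; exact: smoothR_dot.
Qed.

End smooth.
End PlaneProjection.

Section Span3.
Variables (R : realType) (n : nat).
Implicit Types a b c w : 'rV[R]_n.

Definition rows3 a b c : 'M[R]_(3, n) := col_mx (col_mx a b) c.

Lemma mul_rows3 a b c (v : 'rV[R]_3) :
  v *m rows3 a b c = v 0 0 *: a + v 0 1 *: b + v 0 2 *: c.
Proof.
have e1 (u : 'rV[R]_1) (d : 'rV[R]_n) : u *m d = u 0 0 *: d.
  by rewrite [u]mx11_scalar mul_scalar_mx mxE eqxx.
pose v1 : 'rV[R]_(1 + 1) := @lsubmx _ 1 (1 + 1) 1 v.
have -> : v *m rows3 a b c = @lsubmx _ 1 1 1 v1 *m a + @rsubmx _ 1 1 1 v1 *m b +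
    @rsubmx _ 1 (1 + 1) 1 v *m c.
  by rewrite -mul_row_col hsubmxK -mul_row_col hsubmxK.
rewrite !e1 !mxE.
by congr (v _ _ *: _ + v _ _ *: _ + v _ _ *: _); exact/val_inj.
Qed.

Lemma rows3P a b c w :
  (w <= rows3 a b c)%MS <-> exists r s t : R, w = r *: a + s *: b + t *: c.
Proof.
split=> [/submxP[v ->]|[r [s [t ->]]]].
  by rewrite mul_rows3; exists (v 0 0), (v 0 1), (v 0 2).
apply/submxP; exists (\row_i [:: r; s; t]`_i).
by rewrite mul_rows3 !mxE.
Qed.

Lemma rows3_free a b c :
  (forall r s t : R, r *: a + s *: b + t *: c = 0 -> [/\ r = 0, s = 0 & t = 0]) ->
  row_free (rows3 a b c).
Proof.
move=> free; apply: inj_row_free => v; rewrite mul_rows3 => /free[v0 v1 v2].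
apply/rowP => i; rewrite mxE.
case: i => -[|[|[|//]]] i3.
- by rewrite -[RHS]v0; congr (v _ _); exact/val_inj.
- by rewrite -[RHS]v1; congr (v _ _); exact/val_inj.
- by rewrite -[RHS]v2; congr (v _ _); exact/val_inj.
Qed.

End Span3.

(** The parameter plane has an abstract basis (a, b), so that no coordinates enter
    the formulas. The hypothesis [umb] says that the second fundamental form is proportional to the
    metric in every normal direction w, and [nonflat] that the factor is nonzero
    for some w. *)
Section Umbilical.
Variables (R : realType) (m n : nat) (V : set 'rV[R]_m).
Variable x : 'rV[R]_m -> 'rV[R]_n.
Hypotheses (oV : open V) (cV : connected V) (sx : smooth V x).
Hypothesis imm : forall q v, V q -> dder v x q = 0 -> v = 0.

Local Notation X v := (dder v x).
Local Notation XX u v := (dder u (dder v x)).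
Variables a b : 'rV[R]_m.
Hypothesis ab_span : forall v, exists s t, v = s *: a + t *: b.
Hypothesis ab_free : forall s t : R, s *: a + t *: b = 0 -> s = 0 /\ t = 0.
Local Notation normal w q := (forall v, dot (dder v x q) w = 0).

Hypothesis umb : forall q w, V q -> normal w q ->
  exists mu, forall u v, dot (XX u v q) w = mu * dot (X u q) (X v q).
Hypothesis nonflat : forall q, V q ->
  exists2 w, normal w q & dot (XX a a q) w != 0.

Lemma dder_comb (F : 'rV[R]_m -> 'rV[R]_n) q s t : smooth V F -> V q ->
  dder (s *: a + t *: b) F q = s *: dder a F q + t *: dder b F q.
Proof. by move=> sF Vq; rewrite !(dderE _ sF Vq) mulmxDl -!scalemxAl. Qed.

Lemma gramX q : V q -> 0 < gram2 (X a q) (X b q).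
Proof.
move=> Vq; apply: dot_gram_gt0 => s t e.
by apply: ab_free; apply: (imm Vq); rewrite (dder_comb _ _ sx Vq).
Qed.

Let gramX0 q : V q -> gram2 (X a q) (X b q) != 0.
Proof. by move=> /gramX /lt0r_neq0. Qed.

Definition tanproj y q := tproj (X a q) (X b q) y.

Lemma normalP q w : V q -> dot (X a q) w = 0 -> dot (X b q) w = 0 -> normal w q.
Proof. move=> Vq aw bw v; have [s [t ->]] := ab_span v.
by rewrite (dder_comb _ _ sx Vq); exact: dot_comb_eq0.
Qed.

Lemma tanproj_dot y q v : V q -> dot (tanproj y q) (X v q) = dot y (X v q).
Proof.
move=> Vq; apply/eqP; rewrite -subr_eq0 -dotBl dotC; apply/eqP.
move: v; apply: normalP => //; rewrite dotC dotBl; apply/eqP; rewrite subr_eq0; apply/eqP.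
  exact: tproj1 (gramX0 Vq).
exact: tproj2 (gramX0 Vq).
Qed.

Lemma tanproj_normal y q w : normal w q -> dot (tanproj y q) w = 0.
Proof. by move=> nw; apply: tproj_perp. Qed.

(** The mean curvature vector: the normal part of X_aa divided by <X_a, X_a>. It is
    locked so that rewriting with bilinearity of [dot] does not enter it. *)
Definition eta q : 'rV[R]_n :=
  locked ((dot (X a q) (X a q))^-1 *: (XX a a q - tanproj (XX a a q) q)).

Lemma etaE q :
  eta q = (dot (X a q) (X a q))^-1 *: (XX a a q - tanproj (XX a a q) q).
Proof. by rewrite /eta -lock. Qed.

Lemma Xaa_gt0 q : V q -> 0 < dot (X a q) (X a q).
Proof.
move=> Vq; apply: dot_gt0; apply/eqP => /(imm Vq) a0.
have [|/eqP] := ab_free (s := 1) (t := 0).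
  by rewrite a0 scaler0 scale0r addr0.
by rewrite oner_eq0.
Qed.

Lemma eta_perp q : V q -> normal (eta q) q.
Proof.
by move=> Vq v; rewrite etaE dotC dotZl dotBl tanproj_dot// subrr mulr0.
Qed.

(** The factor mu of [umb] for w is found by taking u = v = a, and is
    <eta, w> by definition of eta. *)
Lemma second_form_eta q w u v : V q -> normal w q ->
  dot (XX u v q) w = dot (X u q) (X v q) * dot (eta q) w.
Proof.
move=> Vq nw; have [mu Hmu] := umb Vq nw.
rewrite Hmu etaE dotZl dotBl tanproj_normal// subr0 Hmu.
rewrite [RHS]mulrC; congr (_ * _).
by rewrite mulrCA mulVf ?mulr1// lt0r_neq0// Xaa_gt0.
Qed.

(** The difference of the two sides is normal, and by [second_form_eta] it is
    orthogonal to every normal vector, hence to itself. *)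
Lemma gauss_formula q u v : V q ->
  XX u v q = tanproj (XX u v q) q + dot (X u q) (X v q) *: eta q.
Proof.
move=> Vq; apply/eqP; rewrite -subr_eq0; apply/eqP.
set z := _ - _; have nz : normal z q.
  move=> t; rewrite dotC /z dotBl dotDl tanproj_dot// dotZl (dotC (eta q)) eta_perp//.
  by rewrite mulr0 addr0 subrr.
apply: dot_eq0; rewrite {1}/z dotBl dotDl dotZl second_form_eta// tanproj_normal// add0r.
by rewrite subrr.
Qed.

Let sX v : smooth V (X v) := smooth_dder v sx.
Let sXX u v : smooth V (XX u v) := smooth_dder u (sX v).

Lemma smooth_eta : smooth V eta.
Proof.
apply: (smooth_eq oV (fun q _ => esym (etaE q))); apply: smoothZ => //.
  apply: smoothR_V => //; first by move=> q Vq; exact: lt0r_neq0 (Xaa_gt0 Vq).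
  exact: smoothR_dot.
apply: smoothB => //; apply: smoothD => //; apply: smoothZ => //.
  exact: smoothR_coef1.
exact: smoothR_coef2.
Qed.

Let speed u v : smoothR V (fun q => dot (X u q) (X v q)) := smoothR_dot oV (sX u) (sX v).

(** Differentiate [gauss_formula] along t and pair with a normal vector w. The
    derivatives of the tangential coefficients disappear, and the coefficients
    themselves contribute <X_t, tanproj X_uv> <eta, w> = <X_t, X_uv> <eta, w>. *)
Lemma normal_third_derivative q w t u v : V q -> normal w q ->
  dot (dder t (XX u v) q) w =
  (dot (X t q) (XX u v q) + dder t (fun q => dot (X u q) (X v q)) q) *
    dot (eta q) w + dot (X u q) (X v q) * dot (dder t eta q) w.
Proof.
move=> Vq nw.
pose al q := coef1 (X a q) (X b q) (XX u v q).
pose be q := coef2 (X a q) (X b q) (XX u v q).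
have sal : smoothR V al by exact: smoothR_coef1.
have sbe : smoothR V be by exact: smoothR_coef2.
have s1 := smoothZ oV sal (sX a).
have s2 := smoothZ oV sbe (sX b).
have s3 := smoothZ oV (speed u v) smooth_eta.
have e : forall p, V p -> XX u v p =
    al p *: X a p + be p *: X b p + dot (X u p) (X v p) *: eta p.
  by move=> p Vp; exact: gauss_formula.
have et : dot (X t q) (XX u v q) =
    al q * dot (X t q) (X a q) + be q * dot (X t q) (X b q).
  by rewrite dotC -(tanproj_dot _ t Vq) dotC [LHS]dotDr !dotZr.
rewrite (dder_on oV t Vq e) (dderD t (smoothD oV s1 s2) s3 Vq).
rewrite (dderD t s1 s2 Vq) (dderZ oV t sal (sX a) Vq).
rewrite (dderZ oV t sbe (sX b) Vq) (dderZ oV t (speed u v) smooth_eta Vq).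
rewrite et.
have ta := second_form_eta t a Vq nw; have tb := second_form_eta t b Vq nw.
have na := nw a; have nb := nw b.
move: ta tb na nb => /=.
move: (XX t a q) (XX t b q) (X a q) (X b q) => xta xtb xa xb.
move=> ta tb na nb.
rewrite !(dotDl, dotZl) na nb ta tb.
ring.
Qed.

(** The Codazzi equation. In [normal_third_derivative] the left-hand side and the
    factor of <eta, w>, namely <X_t, X_uv> + <X_tu, X_v> + <X_u, X_tv>, are
    symmetric in t and u, so the remaining term is symmetric as well. *)
Lemma eta_derivative_swap q w t u v : V q -> normal w q ->
  dot (X u q) (X v q) * dot (dder t eta q) w =
  dot (X t q) (X v q) * dot (dder u eta q) w.
Proof.
move=> Vq nw; have := normal_third_derivative t u v Vq nw.
have := normal_third_derivative u t v Vq nw.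
rewrite (dder_swap oV (sX v) t u Vq) => ->.
rewrite !(dder_dot oV _ (sX _) (sX _) Vq) (dder_swap oV sx t u Vq).
lra.
Qed.

(** With u and v ranging over a and b, [eta_derivative_swap] is a homogeneous
    linear system in the two numbers <eta_a, w> and <eta_b, w>, whose determinant
    is the Gram determinant. *)
Lemma eta_parallel q w t : V q -> normal w q -> dot (dder t eta q) w = 0.
Proof.
move=> Vq nw; have := gramX0 Vq; rewrite /gram2.
have e1 := eta_derivative_swap b a a Vq nw; have e2 := eta_derivative_swap b a b Vq nw.
rewrite (dotC (X b q) (X a q)) in e1.
have [s [r ->]] := ab_span t; rewrite (dder_comb _ _ smooth_eta Vq).
rewrite dotDl !dotZl.
move: e1 e2; set E := dot (X a q) (X a q); set F := dot (X a q) (X b q).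
set G := dot (X b q) (X b q); move: (dot (dder a eta q) w) (dot (dder b eta q) w) => pa pb.
move=> e1 e2 g0.
have h1 : (E * G - F ^+ 2) * pb = 0.
  have -> : (E * G - F ^+ 2) * pb = G * (E * pb - F * pa) + F * (G * pa - F * pb).
    by ring.
  by rewrite e1 e2; ring.
have h2 : (E * G - F ^+ 2) * pa = 0.
  have -> : (E * G - F ^+ 2) * pa = E * (G * pa - F * pb) + F * (E * pb - F * pa).
    by ring.
  by rewrite e1 e2; ring.
move/eqP: h1; rewrite mulf_eq0 (negbTE g0) /= => /eqP ->.
move/eqP: h2; rewrite mulf_eq0 (negbTE g0) /= => /eqP ->.
by rewrite !mulr0 addr0.
Qed.

(** Differentiating <eta, X_v> = 0 gives <eta_t, X_v> = - <eta, X_tv>, which is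
    - |eta|^2 <X_t, X_v> by [second_form_eta]; the normal part of eta_t is zero by
    [eta_parallel]. *)
Lemma dder_eta q t : V q -> dder t eta q = - dot (eta q) (eta q) *: X t q.
Proof.
move=> Vq; have ne := eta_perp Vq.
have tang v : dot (dder t eta q) (X v q) =
    - (dot (X t q) (X v q) * dot (eta q) (eta q)).
  have h : dder t (fun q => dot (eta q) (X v q)) q = 0.
    rewrite (dder_on oV (g := fun=> 0) t Vq).
      exact: dder_cst.
    by move=> p Vp; rewrite dotC eta_perp.
  move: h; rewrite (dder_dot oV t smooth_eta (sX v) Vq).
  by rewrite (dotC (eta q)) (second_form_eta t v Vq ne) => /eqP; rewrite addr_eq0 => /eqP.
apply/eqP; rewrite scaleNr -addr_eq0; apply/eqP.
set z := _ + _; have nz : normal z q.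
  by move=> v; rewrite dotC /z dotDl dotZl tang mulrC addNr.
by apply: dot_eq0; rewrite {1}/z dotDl dotZl (eta_parallel t Vq nz) nz mulr0 addr0.
Qed.

Lemma kappa_const p q : V p -> V q ->
  dot (eta q) (eta q) = dot (eta p) (eta p).
Proof.
have sk := smoothR_dot oV smooth_eta smooth_eta.
apply: (locally_constant oV cV (f := fun q => dot (eta q) (eta q))) => r Vr.
split=> [|v]; first exact: smoothR_diff sk Vr.
rewrite (dder_dot oV v smooth_eta smooth_eta Vr) (dder_eta v Vr).
by rewrite (dotC (eta r)) dotZl (eta_perp Vr) mulr0 addr0.
Qed.

Lemma kappa_gt0 q : V q -> 0 < dot (eta q) (eta q).
Proof.
move=> Vq; apply: dot_gt0; apply/eqP => e0.
have [w nw] := nonflat Vq; rewrite (second_form_eta a a Vq nw) e0 dot0l mulr0.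
by rewrite eqxx.
Qed.

Variables (p0 : 'rV[R]_m) (Vp0 : V p0).

Let k := dot (eta p0) (eta p0).

Let k_gt0 : 0 < k. Proof. exact: kappa_gt0. Qed.

Let kE q : V q -> dot (eta q) (eta q) = k.
Proof. by move=> Vq; exact: kappa_const. Qed.

Let dder_etak q t : V q -> dder t eta q = - k *: X t q.
Proof. by move=> Vq; rewrite (dder_eta t Vq) kE. Qed.

Let c := x p0 + k^-1 *: eta p0.

(** Both terms of the derivative X_t + eta_t / k cancel by [dder_eta]. *)
Lemma center_const q : V q -> x q + k^-1 *: eta q = c.
Proof.
move=> Vq.
have s1 : smooth V (fun q => k^-1 *: eta q).
  by apply: (smoothZ oV _ smooth_eta); exact: smoothR_cst.
apply: (locally_constantV oV cV (smoothD oV sx s1)) Vp0 Vq => r v Vr.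
rewrite (dderD v sx s1 Vr) (dderZ oV v (smoothR_cst oV _) smooth_eta Vr).
rewrite dder_cst scale0r add0r (dder_etak _ Vr) scalerA.
by rewrite mulrN mulVf ?lt0r_neq0// scaleN1r subrr.
Qed.

(** The orthogonal projection of w onto the span of X_a, X_b and eta at q; that eta
    is normal and has constant square length k makes it explicit. *)
Definition oscproj w q := tanproj w q + (k^-1 * dot w (eta q)) *: eta q.

Lemma oscproj_perp w q v : V q -> dot (oscproj w q - w) (X v q) = 0.
Proof.
move=> Vq; rewrite dotBl dotDl tanproj_dot// dotZl (dotC (eta q)) eta_perp//.
by rewrite mulr0 addr0 subrr.
Qed.

Lemma oscproj_perp_eta w q : V q -> dot (oscproj w q - w) (eta q) = 0.
Proof.
move=> Vq; rewrite dotBl dotDl (tanproj_normal _ (eta_perp Vq)) dotZl kE// add0r.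
by rewrite mulrAC mulVf ?mul1r ?subrr// lt0r_neq0.
Qed.

(** The derivative P_t of P = oscproj w stays in the span, because the span is closed
    under differentiation. It is also orthogonal to the span: differentiate
    <P - w, X_v> = 0 and <P - w, eta> = 0, and note that P - w is orthogonal to
    the derivatives X_tv and eta_t, which lie in the span. *)
Lemma dder_oscproj w q t : V q -> dder t (oscproj w) q = 0.
Proof.
move=> Vq.
pose al q := coef1 (X a q) (X b q) w.
pose be q := coef2 (X a q) (X b q) w.
have sw := smooth_cst oV w.
have sal : smoothR V al by exact: (smoothR_coef1 oV _ _ sw).
have sbe : smoothR V be by exact: (smoothR_coef2 oV _ _ sw).
have sga : smoothR V (fun q => k^-1 * dot w (eta q)).
  by apply: smoothR_M => //; [exact: smoothR_cst|exact: (smoothR_dot oV sw smooth_eta)].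
have s1 := smoothZ oV sal (sX a).
have s2 := smoothZ oV sbe (sX b).
have s3 := smoothZ oV sga smooth_eta.
have ss : smooth V (oscproj w) by exact: (smoothD oV (smoothD oV s1 s2) s3).
have sd : smooth V (fun q => oscproj w q - w) by exact: smoothB.
have dsd : dder t (fun q => oscproj w q - w) q = dder t (oscproj w) q.
  by rewrite (dderB t ss sw Vq) dder_cst subr0.
have spanned s : normal s q -> dot (eta q) s = 0 -> dot (dder t (oscproj w) q) s = 0.
  move=> ns es.
  have -> : dder t (oscproj w) q =
    (dder t al q *: X a q + al q *: XX t a q) +
    (dder t be q *: X b q + be q *: XX t b q) +
    (dder t (fun q => k^-1 * dot w (eta q)) q *: eta q +
     (k^-1 * dot w (eta q)) *: dder t eta q).
    rewrite -(dderZ oV t sal (sX a) Vq) -(dderZ oV t sbe (sX b) Vq).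
    rewrite -(dderZ oV t sga smooth_eta Vq).
    by rewrite -(dderD t s1 s2 Vq) -(dderD t (smoothD oV s1 s2) s3 Vq).
  rewrite !(dotDl, dotZl) !ns (second_form_eta t a Vq ns) (second_form_eta t b Vq ns).
  by rewrite (eta_parallel t Vq ns) es !mulr0 !addr0.
have tang v : dot (dder t (oscproj w) q) (X v q) = 0.
  have h : dder t (fun q => dot (oscproj w q - w) (X v q)) q = 0.
    rewrite (dder_on oV (g := fun=> 0) t Vq).
      exact: dder_cst.
    by move=> p Vp; exact: oscproj_perp.
  move: h; rewrite (dder_dot oV t sd (sX v) Vq) dsd => h.
  have h2 : dot (oscproj w q - w) (XX t v q) = 0.
    rewrite (gauss_formula t v Vq) dotDr dotZr oscproj_perp_eta// mulr0 addr0.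
    by rewrite dotDr !dotZr !(oscproj_perp _ _ Vq) !mulr0 addr0.
  by rewrite h2 addr0 in h.
have tange : dot (dder t (oscproj w) q) (eta q) = 0.
  have h : dder t (fun q => dot (oscproj w q - w) (eta q)) q = 0.
    rewrite (dder_on oV (g := fun=> 0) t Vq).
      exact: dder_cst.
    by move=> p Vp; exact: oscproj_perp_eta.
  move: h; rewrite (dder_dot oV t sd smooth_eta Vq) dsd (dder_etak _ Vq).
  by rewrite dotZr (oscproj_perp _ _ Vq) mulr0 addr0.
apply: dot_eq0; apply: spanned; last by rewrite dotC.
by move=> v; rewrite dotC.
Qed.

Lemma oscproj_const w q : V q -> oscproj w q = oscproj w p0.
Proof.
move=> Vq.
have sw := smooth_cst oV w.
have ss : smooth V (oscproj w).
  apply: (smoothD oV (smoothD oV _ _)); apply: smoothZ => //.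
  - exact: (smoothR_coef1 oV _ _ sw).
  - exact: (smoothR_coef2 oV _ _ sw).
  - by apply: smoothR_M => //; [exact: smoothR_cst|exact: (smoothR_dot oV sw smooth_eta)].
  - exact: smooth_eta.
apply: (locally_constantV oV cV ss) Vp0 Vq => r v; exact: dder_oscproj.
Qed.

Let E := rows3 (X a p0) (X b p0) (eta p0).

Lemma in_span w : (w <= E)%MS -> oscproj w p0 = w.
Proof.
move=> /rows3P[r [s [t ew]]].
apply/eqP; rewrite -subr_eq0; apply/eqP.
have pa := oscproj_perp w a Vp0; have pb := oscproj_perp w b Vp0.
have pe := oscproj_perp_eta w Vp0.
apply: dot_eq0; rewrite [Z in dot _ Z](_ : _ =
    (coef1 (X a p0) (X b p0) w - r) *: X a p0 +
    (coef2 (X a p0) (X b p0) w - s) *: X b p0 +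
    (k^-1 * dot w (eta p0) - t) *: eta p0).
  by rewrite !dotDr !dotZr pa pb pe !mulr0 !addr0.
transitivity (oscproj w p0 - (r *: X a p0 + s *: X b p0 + t *: eta p0)).
  by rewrite -ew.
by rewrite !scalerBl opprD addrACA opprD [Z in Z + _]addrACA.
Qed.

Lemma span_in w : oscproj w p0 = w -> (w <= E)%MS.
Proof.
move=> <-; apply/rows3P.
by exists (coef1 (X a p0) (X b p0) w), (coef2 (X a p0) (X b p0) w),
  (k^-1 * dot w (eta p0)).
Qed.

Lemma span_free : row_free E.
Proof.
apply: rows3_free => r s t e.
have ne := eta_perp Vp0.
have t0 : t = 0.
  have /eqP : dot (r *: X a p0 + s *: X b p0 + t *: eta p0) (eta p0) = 0.
    by rewrite e dot0l.
  rewrite dotDl dotZl (dot_comb_eq0 _ _ (ne a) (ne b)) add0r mulf_eq0.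
  by move=> /orP[/eqP//|]; rewrite gt_eqF.
move: e; rewrite t0 scale0r addr0 -(dder_comb _ _ sx Vp0) => /(imm Vp0) /ab_free[-> ->].
by split.
Qed.

Lemma oscproj_normal w q : V q -> (forall v, dot (X v q) w = 0) ->
  oscproj w q = (k^-1 * dot w (eta q)) *: eta q.
Proof.
move=> Vq nw; rewrite /oscproj /tanproj tproj_eq0 ?add0r//; by rewrite dotC.
Qed.

Lemma x_sub_c q : V q -> x q - c = (- k^-1) *: eta q.
Proof. by move=> Vq; rewrite -(center_const Vq) opprD addNKr scaleNr. Qed.

Let r : R := (Num.sqrt k)^-1.

Let r2 : r ^+ 2 = k^-1.
Proof. by rewrite /r exprVn sqr_sqrtr// ltW. Qed.

Lemma x_in_sphere q : V q -> sphere2 c E r (x q).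
Proof.
move=> Vq; split; rewrite (x_sub_c Vq).
  apply/scalemx_sub/span_in; rewrite -(oscproj_const _ Vq).
  rewrite (oscproj_normal Vq (eta_perp Vq)) (kE Vq) mulVf ?scale1r//.
  by rewrite lt0r_neq0.
rewrite dotZl dotZr (kE Vq) r2 mulrA mulrNN -mulrA.
by rewrite mulVf ?lt0r_neq0// mulr1.
Qed.

(** At the point x q given by [nearest_point], y - x q lies in the 3-space and is
    normal, so y - x q = g eta. Both y and x q being on the sphere,
    g (g k - 2) = 0; the root g = 2 / k is the antipode of x q, at square distance
    4 / k. *)
Lemma sphere_near_in_image p : V p -> exists2 d : R, 0 < d &
  forall y, sphere2 c E r y -> dot (y - x p) (y - x p) < d -> (x @` V) y.
Proof.
move=> Vp; have [d d0 Hd] := nearest_point oV sx imm Vp.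
exists (Num.min d (4 / k)); first by rewrite lt_min d0 divr_gt0.
move=> y [yE yr]; rewrite lt_min => /andP[yd yk].
have [q [Vq qp qn]] := Hd y yd.
exists q => //.
have yq : y - x q = (k^-1 * dot (y - x q) (eta q)) *: eta q.
  rewrite -(oscproj_normal Vq qn) (oscproj_const _ Vq) in_span//.
  have -> : y - x q = (y - c) - (x q - c) by rewrite opprB subrKA.
  apply: addmx_sub => //; rewrite eqmx_opp.
  by have [] := x_in_sphere Vq.
move: yq; set g := _ * _ => yq.
have yc : y - c = (g - k^-1) *: eta q.
  have -> : y - c = (y - x q) + (x q - c) by rewrite subrKA.
  by rewrite (x_sub_c Vq) {1}yq -scalerDl.
move: yr; rewrite r2 yc dotZl dotZr (kE Vq) => yr.
have : g * (g * k - 2) = 0.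
  have kk : k^-1 * k = 1 by rewrite mulVf// lt0r_neq0.
  have -> : g * (g * k - 2) =
      (g - k^-1) * ((g - k^-1) * k) - k^-1 * (k^-1 * k) + 2 * g * (k^-1 * k - 1).
    by ring.
  by rewrite yr kk mulr1 !subrr mulr0 addr0.
move/eqP; rewrite mulf_eq0 => /orP[/eqP g0|/eqP gk].
  by apply/eqP; rewrite eq_sym -subr_eq0 yq g0 scale0r.
have : 4 / k <= dot (y - x q) (y - x q).
  rewrite yq dotZl dotZr (kE Vq) ler_pdivrMr//.
  have -> : g * (g * k) * k = (g * k) ^+ 2 by rewrite expr2; ring.
  have -> : g * k = 2 by lra.
  by rewrite expr2 -natrM.
by move=> /le_lt_trans /(_ (le_lt_trans qp yk)); rewrite ltxx.
Qed.

(** The open set is the union of the balls provided by [sphere_near_in_image]. *)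
Lemma umbilical_open_part : open_part_of_2sphere (x @` V).
Proof.
pose O := [set y | exists p d, [/\ V p, dot (y - x p) (y - x p) < d &
  forall y', sphere2 c E r y' -> dot (y' - x p) (y' - x p) < d -> (x @` V) y']].
exists c, E, r, O; split.
- exact: span_free.
- by rewrite invr_gt0 sqrtr_gt0.
- rewrite openE => y [p [d [Vp yd Hp]]].
  have sid : smooth setT (fun y : 'rV[R]_n => y - x p).
    apply: smoothB; [exact: openT| |exact/smooth_cst/openT].
    apply: (smooth_eq openT _ (smooth_reindex openT id)) => z _.
    by apply/rowP => j; rewrite mxE.
  have /= cy := smoothR_cont (smoothR_dot openT sid sid) (I : setT y).
  have near_d : \forall z \near y, dot (z - x p) (z - x p) < d.
    exact: (cvgr_lt _ cy _ yd).
  by apply: filterS near_d => z zd; exists p, d.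
- apply/seteqP; split => [y [q Vq <-]|y [[p [d [Vp yd Hp]]] ys]]; last exact: Hp.
  split; last exact: x_in_sphere.
  have [d d0 Hd] := sphere_near_in_image Vq.
  by exists q, d; split => //; rewrite subrr dot0l.
Qed.

End Umbilical.

(** The basis (a, b) is now the canonical one. When V is empty, the bound on n
    provides a 3-space, hence a sphere. *)
Theorem umbilical_surface_spherical (R : realType) (n : nat) (V : set 'rV[R]_2)
    (x : 'rV[R]_2 -> 'rV[R]_n) : (2 < n)%N ->
  open V -> connected V -> smooth V x ->
  (forall q v, V q -> dder v x q = 0 -> v = 0) ->
  (forall q w, V q -> (forall v, dot (dder v x q) w = 0) -> exists mu,
     forall u v, dot (dder u (dder v x) q) w = mu * dot (dder u x q) (dder v x q)) ->
  (forall q, V q -> exists2 w, (forall v, dot (dder v x q) w = 0) &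
     dot (dder 'e_0 (dder 'e_0 x) q) w != 0) ->
  open_part_of_2sphere (x @` V).
Proof.
move=> n2 oV cV sx imm umb nonflat.
have dir v : v = v 0 0 *: 'e_0 + v 0 1 *: 'e_1 :> 'rV[R]_2.
  rewrite [LHS]row_sum_delta big_ord_recl big_ord1.
  by rewrite (_ : lift ord0 ord0 = 1)//; exact/val_inj.
have [->|/set0P[p0 Vp0]] := eqVneq V set0; last first.
  apply: (umbilical_open_part oV cV sx imm (a := 'e_0) (b := 'e_1) _ _ umb nonflat Vp0).
    by move=> v; exists (v 0 0), (v 0 1); exact: dir.
  move=> s t /rowP e; have := e 0; have := e 1.
  by rewrite !mxE /= !mulr0 !mulr1 addr0 add0r.
rewrite image_set0.
exists 0, (pid_mx 3), 1, set0; split => //; last by rewrite set0I.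
  by rewrite /row_free rank_pid_mx.
Qed.

(** * Self-adjoint operators with a double eigenvalue *)

(** If P = C R is a rank factorization, then C R C R = C R and cancelling C on the
    left and R on the right yields R C = 1; so tr P = tr (R C) = rank P. *)
Lemma mxtrace_idempotent (F : fieldType) (n : nat) (P : 'M[F]_n) :
  P *m P = P -> \tr P = (\rank P)%:R.
Proof.
move=> PP; have RC : row_base P *m col_base P = 1%:M.
  apply: (row_free_inj (row_base_free P)).
  apply: (row_full_inj (col_base_full P)).
  rewrite /mulmxr /= mul1mx -(mulmxA (row_base P)) mulmx_base.
  by rewrite (mulmxA (col_base P)) mulmx_base.
by rewrite -{1}[P]mulmx_base mxtrace_mulC RC mxtrace1.
Qed.

Lemma idempotent_tr0 (R : realType) (n : nat) (P : 'M[R]_n) :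
  P *m P = P -> \tr P = 0 -> P = 0.
Proof.
move=> /mxtrace_idempotent -> /eqP; rewrite pnatr_eq0 mxrank_eq0.
by move=> /eqP.
Qed.

Lemma mul_tr_eq0 (R : realType) (m n : nat) (A : 'M[R]_(m, n)) :
  A *m A^T = 0 -> A = 0.
Proof.
move=> h; apply/row_matrixP => i; rewrite row0; apply: dot_eq0.
have /matrixP/(_ i i) := h; rewrite !mxE => <-.
by apply: eq_bigr => j _; rewrite !mxE.
Qed.

(** S acts on coordinate rows and J sends coordinates to tangent vectors, so
    G = J J^T is the Gram matrix of the metric and A G = G A^T expresses that A is
    self-adjoint for it. *)
Section SelfAdjoint.
Variables (R : realType) (n k : nat).
Variables (S : 'M[R]_n.+1) (J : 'M[R]_(n.+1, k)).
Hypothesis Jfree : row_free J.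
Let G := J *m J^T.

(** (A J) (A J)^T = A G A^T = A A G. *)
Lemma selfadj_sq0 A : A *m G = G *m A^T -> A *m A = 0 -> A = 0.
Proof.
move=> sA A2; apply: (row_free_inj Jfree); rewrite mul0mx.
apply: mul_tr_eq0; rewrite trmx_mul -mulmxA [J *m _]mulmxA -/G -sA.
by rewrite mulmxA A2 mul0mx.
Qed.

Lemma selfadjM A B : A * B = B * A -> A *m G = G *m A^T -> B *m G = G *m B^T ->
  A *m B *m G = G *m (A *m B)^T.
Proof.
move=> AB sA sB.
have e : A *m B = B *m A := AB.
by rewrite [in RHS]e trmx_mul -mulmxA sB mulmxA sA -mulmxA.
Qed.

Lemma selfadjX A i : A *m G = G *m A^T -> (A ^+ i) *m G = G *m (A ^+ i)^T.
Proof.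
move=> sA; elim: i => [|i IH].
  by rewrite expr0 trmx1 mulmx1 mul1mx.
rewrite exprS; apply: selfadjM => //.
by rewrite -exprS exprSr.
Qed.

(** Raise the exponent to a power of 2 and halve it repeatedly with
    [selfadj_sq0]. *)
Lemma selfadj_nilpotent A i : A *m G = G *m A^T -> A ^+ i = 0 -> A = 0.
Proof.
move=> sA Ai.
have : A ^+ (2 ^ i) = 0.
  by rewrite -(subnK (ltnW (ltn_expl i (ltnSn 1)))) exprD Ai mulr0.
elim: {Ai}i => [|i IH] //.
rewrite expnS mulnC exprM expr2 => /(selfadj_sq0 (selfadjX _ sA)).
exact: IH.
Qed.

Variable nu : R.
Hypothesis nu0 : nu != 0.
Hypothesis sS : S *m G = G *m S^T.
Hypothesis Schar : char_poly S =
  ('X - nu%:P) * ('X - nu%:P) * 'X^(n.+1 - 2).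

(** By Cayley-Hamilton the self-adjoint operator S (S - nu) is nilpotent. *)
Lemma selfadj_sq : S *m S = nu *: S.
Proof.
pose A := S * (S - nu%:M).
suff : A = 0.
  rewrite /A mulrBr => /eqP; rewrite subr_eq0 => /eqP.
  by rewrite -[S * nu%:M]/(S *m nu%:M) mul_mx_scalar.
have sN : (S - nu%:M) *m G = G *m (S - nu%:M)^T.
  by rewrite mulmxBl linearB /= tr_scalar_mx mulmxBr sS mul_mx_scalar mul_scalar_mx.
have comm : GRing.comm S (S - nu%:M).
  by apply: commrB => //; exact: comm_mx_scalar.
have sA : A *m G = G *m A^T by apply: selfadjM.
apply: (selfadj_nilpotent (i := n.+2) sA).
rewrite exprMn_comm//.
have -> : S ^+ n.+2 * (S - nu%:M) ^+ n.+2 =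
    horner_mx S ('X^(n.+2) * ('X - nu%:P) ^+ n.+2).
  by rewrite rmorphM !rmorphXn rmorphB /= horner_mx_X horner_mx_C.
have le : (n.+1 - 2 <= n.+2)%N by rewrite leq_subLR addnC ltnW// ltnS leq_addr.
have -> : 'X^(n.+2) * ('X - nu%:P) ^+ n.+2 =
    char_poly S * ('X^(n.+2 - (n.+1 - 2)) * ('X - nu%:P) ^+ n).
  rewrite Schar -{1}(subnKC le) exprD 2!exprS.
  by rewrite !mulrA; ring.
by rewrite rmorphM /= Cayley_Hamilton mul0r.
Qed.

Lemma selfadj_trace : (0 < n)%N -> \tr S = nu + nu.
Proof.
case: n S Schar => [|n'] S' char' // _.
have := char_poly_trace S' isT.
rewrite char' coefMXn subSS subn1 /= ltnNge leqnSn /= subSnn.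
rewrite coefM !big_ord_recl big_ord0 !coefB !coefX !coefC /=.
by move/eqP; rewrite -eqr_oppLR => /eqP <-; ring.
Qed.

(** S / nu is idempotent of trace 2, and so is the orthogonal projection Q onto the
    plane of X and Y, which it fixes. Their difference is idempotent of trace 0,
    hence zero. *)
Lemma selfadj_rank2 (X Y : 'rV[R]_n.+1) : (0 < n)%N ->
  X *m S = nu *: X -> Y *m S = nu *: Y ->
  dot (X *m J) (X *m J) = 1 -> dot (Y *m J) (Y *m J) = 1 ->
  dot (X *m J) (Y *m J) = 0 ->
  forall a, dot (a *m J) (X *m J) = 0 -> dot (a *m J) (Y *m J) = 0 -> a *m S = 0.
Proof.
move=> n0 XS YS XX YY XY.
pose pr (x y : 'rV[R]_n.+1) : 'M[R]_n.+1 := J *m (x *m J)^T *m y.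
have mul_pr a x y : a *m pr x y = dot (a *m J) (x *m J) *: y.
  rewrite /pr !mulmxA [a *m J *m _]mx11_scalar mul_scalar_mx.
  by rewrite dotE.
pose Q := pr X X + pr Y Y.
have XQ : X *m Q = X.
  by rewrite mulmxDr !mul_pr XX XY scale1r scale0r addr0.
have YQ : Y *m Q = Y.
  by rewrite mulmxDr !mul_pr YY (dotC (Y *m J)) XY scale1r scale0r add0r.
have prM x y (B : 'M[R]_n.+1) : pr x y *m B = pr x (y *m B).
  by rewrite /pr -mulmxA.
have QQ : Q *m Q = Q by rewrite {1}/Q mulmxDl !prM XQ YQ.
have QS : Q *m S = nu *: Q.
  by rewrite /Q mulmxDl !prM XS YS /pr -!scalemxAr scalerDr.
have Spr x y : x *m S = nu *: x -> S *m pr x y = nu *: pr x y.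
  move=> xS; rewrite /pr trmx_mul !mulmxA -(mulmxA S J) -/G sS.
  by rewrite -(mulmxA G) -trmx_mul xS linearZ /= -scalemxAr -!scalemxAl.
have SQ : S *m Q = nu *: Q by rewrite mulmxDr !Spr// -scalerDr.
have trQ : \tr Q = 1 + 1.
  have tr_pr x : \tr (pr x x) = dot (x *m J) (x *m J).
    by rewrite /pr mxtrace_mulC mulmxA trace_mx11 dotE.
  by rewrite /Q linearD /= !tr_pr XX YY.
pose P := nu^-1 *: S - Q.
have PP : P *m P = P.
  rewrite /P mulmxBl !mulmxBr -!scalemxAl -!scalemxAr QS SQ QQ selfadj_sq.
  by rewrite !scalerA mulVf// !scale1r mulrAC mulVf// mul1r subrr subr0.
have P0 : P = 0.
  apply: idempotent_tr0 => //.
  by rewrite /P linearB linearZ /= trQ selfadj_trace// mulrDr mulVf// subrr.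
have SE : S = nu *: Q.
  move/eqP: P0; rewrite subr_eq0 => /eqP <-.
  by rewrite scalerA mulfV// scale1r.
move=> a aX aY.
by rewrite SE -scalemxAr mulmxDr !mul_pr aX aY !scale0r addr0 scaler0.
Qed.

End SelfAdjoint.

(** * Shape operator of a hypersurface *)

Lemma selfadj_of_sym (R : realType) (n k : nat) (S : 'M[R]_n)
    (J K : 'M[R]_(n, k)) : S *m J = - K -> K *m J^T = J *m K^T ->
  S *m (J *m J^T) = J *m J^T *m S^T.
Proof.
move=> SJ sym; rewrite mulmxA SJ mulNmx sym -mulmxA -trmx_mul SJ.
by rewrite -mulmxN; congr (_ *m _); apply/matrixP => i j; rewrite !mxE.
Qed.

Lemma selfadj_third_form (R : realType) (n k : nat) (S : 'M[R]_n) (J : 'M[R]_(n, k))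
    (nu : R) (b c : 'rV[R]_n) :
  S *m (J *m J^T) = J *m J^T *m S^T -> S *m S = nu *: S ->
  dot (b *m S *m J) (c *m S *m J) = nu * dot (b *m S *m J) (c *m J).
Proof.
move=> sS SS.
have -> : dot (b *m S *m J) (c *m S *m J) =
    (b *m (S *m (J *m J^T *m S^T)) *m c^T) 0 0.
  by rewrite dotE !trmx_mul !mulmxA.
have -> : dot (b *m S *m J) (c *m J) = (b *m (S *m (J *m J^T)) *m c^T) 0 0.
  by rewrite dotE !trmx_mul !mulmxA.
by rewrite -sS (mulmxA S) SS -scalemxAl -scalemxAr -scalemxAl mxE.
Qed.

Section Hypersurface.
Variables (R : realType) (n : nat) (U : set 'rV[R]_n).
Variables (f N : 'rV[R]_n -> 'rV[R]_n.+1).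
Hypothesis fN : hypersurface U f N.

Let oU : open U. Proof. by case: fN => -[]. Qed.
Let sf : smooth U f. Proof. by case: fN => -[]. Qed.
Let sN : smooth U N. Proof. by case: fN => _ []. Qed.

Lemma jac_free p : U p -> row_free ('J f p).
Proof. by case: fN => -[_ _ +] _; apply. Qed.

Lemma normal_unit p : U p -> dot (N p) (N p) = 1.
Proof. by case: fN => _ [_ + _]; apply. Qed.

Lemma normal_tangent p v : U p -> dot (dder v f p) (N p) = 0.
Proof. by move=> Up; rewrite (dderE v sf Up); case: fN => _ [_ _]; apply. Qed.

Lemma dder_normal_tangent p v : U p -> dot (dder v N p) (N p) = 0.
Proof.
move=> Up.
have h : dder v (fun p => dot (N p) (N p)) p = 0.
  rewrite (dder_on oU (g := fun=> 1 : R) v Up); first exact: dder_cst.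
  exact: normal_unit.
move: h; rewrite (dder_dot oU v sN sN Up) (dotC (N p)) => h; lra.
Qed.

(** Both sides are - <D_u D_v f, N>, by differentiating <D_v f, N> = 0. *)
Lemma second_form_sym p u v : U p ->
  dot (dder u N p) (dder v f p) = dot (dder v N p) (dder u f p).
Proof.
move=> Up.
have h t w : dot (dder t N p) (dder w f p) = - dot (dder t (dder w f) p) (N p).
  have : dder t (fun p => dot (dder w f p) (N p)) p = 0.
    rewrite (dder_on oU (g := fun=> 0 : R) t Up); first exact: dder_cst.
    by move=> q Uq; exact: normal_tangent.
  rewrite (dder_dot oU t (smooth_dder w sf) sN Up) (dotC (dder w f p)) => /eqP.
  by rewrite addrC addr_eq0 => /eqP.
by rewrite !h (dder_swap oU sf u v Up).
Qed.

(** The tangent space has the dimension of the hyperplane orthogonal to N and is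
    contained in it. *)
Lemma tangentP p w : U p -> dot w (N p) = 0 -> exists a, w = dder a f p.
Proof.
move=> Up wN.
have N0 : N p != 0.
  apply/eqP => N0; have := normal_unit Up; rewrite N0 dot0l => /eqP.
  by rewrite eq_sym oner_eq0.
have rN : \rank (N p)^T = 1%N.
  by rewrite mxrank_tr rank_rV N0.
have perp : (w <= kermx (N p)^T)%MS.
  by apply/sub_kermxP/matrixP => i j; rewrite !ord1 -dotE wN mxE.
have sJ : ('J f p <= kermx (N p)^T)%MS.
  apply/sub_kermxP/row_matrixP => i; rewrite row_mul row0 rowE.
  apply/matrixP => k j; rewrite !ord1 -dotE -(dderE _ sf Up) normal_tangent//.
  by rewrite mxE.
have eqr : \rank ('J f p) = \rank (kermx (N p)^T).
  by rewrite mxrank_ker rN subn1; apply/eqP/jac_free.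
have : (kermx (N p)^T <= 'J f p)%MS.
  by rewrite -(geq_leqif (mxrank_leqif_sup sJ)) eqr.
move=> /(submx_trans perp)/submxP[a ->]; exists a.
by rewrite (dderE _ sf Up).
Qed.

Local Notation S := (shape_operator f N).

Lemma shape_jac p : U p -> S p *m 'J f p = - 'J N p.
Proof.
move=> Up; rewrite /shape_operator mulmxKpV//.
apply/row_subP => i.
have [a ea] : exists a, row i (- 'J N p) = dder a f p.
  apply: tangentP => //; rewrite linearN /= dotNl rowE -(dderE _ sN Up).
  by rewrite dder_normal_tangent// oppr0.
by rewrite ea (dderE _ sf Up) submxMl.
Qed.

Lemma dder_shape p v : U p -> dder v N p = - (v *m S p *m 'J f p).
Proof. by move=> Up; rewrite -mulmxA shape_jac// mulmxN opprK (dderE v sN Up). Qed.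

Lemma shape_selfadj p : U p ->
  S p *m ('J f p *m ('J f p)^T) = 'J f p *m ('J f p)^T *m (S p)^T.
Proof.
move=> Up.
have e (A B : 'M[R]_(n, n.+1)) i j :
    (A *m B^T) i j = dot ('e_i *m A) ('e_j *m B).
  by rewrite -!rowE !mxE; apply: eq_bigr => k _; rewrite !mxE.
have sym : 'J N p *m ('J f p)^T = 'J f p *m ('J N p)^T.
  apply/matrixP => i j.
  have h1 : ('J N p *m ('J f p)^T) i j = dot (dder 'e_i N p) (dder 'e_j f p).
    by rewrite (dderE 'e_i sN Up) (dderE 'e_j sf Up); exact: (e ('J N p) ('J f p)).
  have h2 : ('J f p *m ('J N p)^T) i j = dot (dder 'e_j N p) (dder 'e_i f p).
    rewrite (dderE 'e_i sf Up) (dderE 'e_j sN Up) dotC.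
    exact: (e ('J f p) ('J N p)).
  exact: etrans h1 (etrans (second_form_sym _ _ Up) (esym h2)).
exact: selfadj_of_sym (shape_jac Up) sym.
Qed.

End Hypersurface.

Section BiUmbilical.
Variables (R : realType) (m : nat) (U : set 'rV[R]_m.+3).
Variables (f N : 'rV[R]_m.+3 -> 'rV[R]_m.+4).
Hypothesis bi : bi_umbilical U f N.

Let fN : hypersurface U f N. Proof. by case: bi => -[]. Qed.
Let oU : open U. Proof. by case: fN => -[]. Qed.
Let sf : smooth U f. Proof. by case: fN => -[]. Qed.
Let sN : smooth U N. Proof. by case: fN => _ []. Qed.

(** S^2 = nu S in terms of N and f: the third fundamental form is nu times the
    second one. *)
Lemma third_form_proportional p : U p -> exists nu, forall b c,
  dot (dder b N p) (dder c N p) = - nu * dot (dder b N p) (dder c f p).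
Proof.
move=> Up; have [[_ /(_ p Up)[nu [nu2 h]]] /(_ p Up) eqnu] := bi.
have e := eqnu _ _ h; rewrite -{}e in h; have [nu0 _ ch] := h.
have SS := selfadj_sq (jac_free fN Up) (shape_selfadj fN Up) ch.
exists nu => b c; rewrite !(dder_shape fN _ Up) (dderE c sf Up).
rewrite dotNl dotNr dotNl opprK mulrNN.
exact: selfadj_third_form (shape_selfadj fN Up) SS.
Qed.

Lemma frame_kernel p X Y : U p -> Delta_frame f N p X Y -> exists nu,
  [/\ nu != 0, X *m shape_operator f N p = nu *: X,
      Y *m shape_operator f N p = nu *: Y &
   forall a, dot (a *m 'J f p) (X *m 'J f p) = 0 ->
      dot (a *m 'J f p) (Y *m 'J f p) = 0 -> dder a N p = 0].
Proof.
move=> Up [XX YY XY [nu [nu2 [h XS YS]]]].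
have e := bi.2 p Up _ _ h; rewrite -{}e in h YS; have [nu0 _ ch] := h.
exists nu; split => // a aX aY.
rewrite (dder_shape fN _ Up).
rewrite (selfadj_rank2 (jac_free fN Up) nu0 (shape_selfadj fN Up) ch _ XS YS)//.
by rewrite mul0mx oppr0.
Qed.

End BiUmbilical.

(** * Integral surfaces of the eigenplane distribution *)

Section Codazzi.
Variables (R : realType) (n k : nat) (U : set 'rV[R]_n).
Variables (f N : 'rV[R]_n -> 'rV[R]_k).
Hypotheses (oU : open U) (sf : smooth U f) (sN : smooth U N).
Hypothesis sym : forall p b c, U p ->
  dot (dder b N p) (dder c f p) = dot (dder c N p) (dder b f p).
Hypothesis normal_third_derivative : forall p, U p -> exists nu, forall b c,
  dot (dder b N p) (dder c N p) = - nu * dot (dder b N p) (dder c f p).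

(** The hypothesis [third] is differentiated along a, at a point where a is a nullity
    direction. To avoid differentiating nu it is used in the cross-multiplied form
    <N_t, N_s> <N_e, f_e> = <N_e, N_e> <N_t, f_s>, with e a fixed direction for which
    <N_e, f_e> is nonzero at p. With N_s = - la f_s and N_t = - la f_t at p
    this determines <N_as, f_t> + la <f_t, f_as>, a quantity equal to
    <N_st, f_a> by the derivative of <N_t, f_a> = <N_a, f_t> along s. *)
Lemma nullity_second_form p a e (la : R) : U p -> la != 0 -> dder a N p = 0 ->
  dder e f p != 0 -> dder e N p = - la *: dder e f p ->
  exists mu, forall s t, dder s N p = - la *: dder s f p ->
    dder t N p = - la *: dder t f p ->
    dot (dder s (dder t N) p) (dder a f p) = mu * dot (dder s f p) (dder t f p).
Proof.
move=> Up la0 aN ef0 eN.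
have Df v := smooth_dder v sf; have DN v := smooth_dder v sN.
have E0 : dot (dder e f p) (dder e f p) != 0 by rewrite lt0r_neq0// dot_gt0.
pose A b c q := dot (dder b N q) (dder c N q).
pose H b c q := dot (dder b N q) (dder c f q).
have sA b c : smoothR U (A b c) by exact: (smoothR_dot oU (DN b) (DN c)).
have sH b c : smoothR U (H b c) by exact: (smoothR_dot oU (DN b) (Df c)).
exists (- (dder a (A e e) p + la * dder a (H e e) p) /
  (la * dot (dder e f p) (dder e f p))) => s t sN' tN'.
have d1 : dder s (H t a) p = dder s (H a t) p.
  by apply: (dder_on oU) => // q Uq; exact: sym.
have d2 : dder a (fun q => A t s q * H e e q) p = dder a (fun q => A e e q * H t s q) p.
  apply: (dder_on oU) => // q Uq; have [nu h] := normal_third_derivative Uq.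
  by rewrite /A /H !h; ring.
move: d1; rewrite (dder_dot oU s (DN t) (Df a) Up) (dder_dot oU s (DN a) (Df t) Up).
rewrite aN dot0l addr0 tN' dotZl.
rewrite (dder_swap oU sN s a Up) (dder_swap oU sf s a Up) => d1.
move: d2; rewrite (dderM a (sA t s) (sH e e) Up) (dderM a (sA e e) (sH t s) Up).
rewrite (dder_dot oU a (DN t) (DN s) Up) (dder_dot oU a (DN t) (Df s) Up).
rewrite /A /H !eN !tN' !sN' !(dotZl, dotZr) (dotC (dder t f p) (dder s f p)).
rewrite -/(A e e) -/(H e e).
move: (dder a (A _ _) p) (dder a (H _ _) p) => dC dB d2.
rewrite (dotC (dder t f p) (dder a (dder s N) p)) in d2.
move: d1 d2 E0.
move: (dot (dder e f p) _) (dot (dder s f p) _) (dot (dder t f p) _).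
move: (dot (dder s (dder t N) p) _) (dot (dder a (dder s N) p) _) (dot (dder a (dder t N) p) _).
move=> x y z E g K d1 d2 E0.
have key : la * (la * E * x + (dC + la * dB) * g) = 0.
  have -> : la * (la * E * x + (dC + la * dB) * g) =
     ((- la * z + - la * y) * (- la * E) + - la * (- la * g) * dB) -
     (dC * (- la * g) + - la * (- la * E) * (z + - la * K)) +
     la * la * E * (x + - la * K - y) by ring.
  by rewrite d2 d1 !subrr mulr0 addr0.
move/eqP: key; rewrite mulf_eq0 (negbTE la0) /= => /eqP key.
apply/eqP; rewrite -subr_eq0.
have -> : x - - (dC + la * dB) / (la * E) * g =
    (la * E * x + (dC + la * dB) * g) / (la * E).
  by field; rewrite la0 E0.
by rewrite key mul0r.
Qed.

End Codazzi.

Section Comp2.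
Variables (R : realType) (m n l : nat) (V : set 'rV[R]_m) (U : set 'rV[R]_n).
Variables (s : 'rV[R]_m -> 'rV[R]_n) (g : 'rV[R]_n -> 'rV[R]_l).
Hypotheses (oV : open V) (oU : open U) (ss : smooth V s) (sg : smooth U g).
Hypothesis sVU : forall q, V q -> U (s q).

(** The second derivative of a composition; symmetry of second derivatives turns the
    sum of (s_v)_i (D_i g)_{s_u} into a single iterated derivative with frozen
    directions s_u and s_v. *)
Lemma dder_comp2 q u v : V q ->
  dder u (dder v (fun q => g (s q))) q =
  dder (dder u s q) (dder (dder v s q) g) (s q) + dder (dder u (dder v s) q) g (s q).
Proof.
move=> Vq; have Up := sVU Vq.
have sv := smooth_dder v ss.
have sgi i : smooth V (fun q => dder 'e_i g (s q)).
  exact: (smooth_comp oV oU ss sVU (smooth_dder 'e_i sg)).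
have e : dder u (dder v (fun q => g (s q))) q =
    dder u (fun q => \sum_i dder v s q 0 i *: dder 'e_i g (s q)) q.
  apply: (dder_on oV) => // r Vr; have Ur := sVU Vr.
  rewrite (dder_comp ss v Vr (smooth_diff sg Ur)).
  exact: (dder_basis _ (smooth_diff sg Ur)).
have -> : dder (dder u s q) (dder (dder v s q) g) (s q) =
    \sum_i dder v s q 0 i *: dder (dder u s q) (dder 'e_i g) (s q).
  rewrite (dder_swap oU sg _ _ Up).
  rewrite (dder_basis _ (smooth_diff (smooth_dder _ sg) Up)).
  by apply: eq_bigr => i _; rewrite (dder_swap oU sg _ _ Up).
have -> : dder (dder u (dder v s) q) g (s q) =
    \sum_i dder u (dder v s) q 0 i *: dder 'e_i g (s q).
  exact: (dder_basis _ (smooth_diff sg Up)).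
rewrite {}e -big_split /= (dder_sum (U := V)); last first.
- exact: Vq.
- by move=> i; apply: smoothZ => //; exact: (smooth_coord oV i sv).
apply: eq_bigr => i _.
rewrite (dderZ oV u (smooth_coord oV i sv) (sgi i) Vq) addrC; congr (_ + _).
  by rewrite (dder_coord u i sv Vq).
congr (_ *: _).
exact: (dder_comp (f := dder 'e_i g) ss u Vq (smooth_diff (smooth_dder 'e_i sg) Up)).
Qed.

End Comp2.

Section IntegralSurface.
Variables (R : realType) (m : nat) (U : set 'rV[R]_m.+3).
Variables (f N : 'rV[R]_m.+3 -> 'rV[R]_m.+4).
Variables (V : set 'rV[R]_2) (s : 'rV[R]_2 -> 'rV[R]_m.+3).
Hypothesis bi : bi_umbilical U f N.
Hypothesis int : integral_surface f N U V s.

Let fN : hypersurface U f N. Proof. by case: bi => -[]. Qed.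
Let oU : open U. Proof. by case: fN => -[]. Qed.
Let sf : smooth U f. Proof. by case: fN => -[]. Qed.
Let sN : smooth U N. Proof. by case: fN => _ []. Qed.
Let oV : open V. Proof. by case: int. Qed.
Let ss : smooth V s. Proof. by case: int. Qed.
Let sVU q : V q -> U (s q). Proof. by case: int => _ _ _ + _; apply. Qed.

Let x q := f (s q).
Let nn q := N (s q).
Let sx : smooth V x := smooth_comp oV oU ss sVU sf.
Let sn : smooth V nn := smooth_comp oV oU ss sVU sN.

Let xE q v : V q -> dder v x q = dder (dder v s q) f (s q).
Proof. by move=> Vq; rewrite (dder_comp ss v Vq (smooth_diff sf (sVU Vq))). Qed.

Let nE q v : V q -> dder v nn q = dder (dder v s q) N (s q).
Proof. by move=> Vq; rewrite (dder_comp ss v Vq (smooth_diff sN (sVU Vq))). Qed.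

(** The tangent plane of the surface is spanned by the images of X and Y. So ds(v) is
    an eigenvector for la, which yields the Weingarten formula n_v = - la x_v, and
    a tangent vector of the hypersurface orthogonal to the surface is orthogonal
    to X and Y, hence in the kernel of the shape operator. *)
Lemma integral_surface_frame q : V q ->
  (forall v, dder v x q = 0 -> v = 0) /\
  exists la, [/\ la != 0,
    forall v, dder (dder v s q) N (s q) = - la *: dder (dder v s q) f (s q) &
    forall a, (forall v, dot (dder v x q) (dder a f (s q)) = 0) -> dder a N (s q) = 0].
Proof.
move=> Vq; have Up := sVU Vq.
have [_ _ _ _ /(_ q Vq)[X [Y [fr /andP[le1 le2]]]]] := int.
have Jx v : dder v x q = v *m 'J (f \o s) q := dderE v sx Vq.
have [XX YY XY _] := fr.
have [la [la0 XS YS ker]] := frame_kernel bi Up fr.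
split.
  have rk : row_free ('J (f \o s) q).
    rewrite /row_free eqn_leq rank_leq_row /=.
    apply: leq_trans (mxrankS le2).
    suff : row_free (col_mx (X *m 'J f (s q)) (Y *m 'J f (s q))).
      by rewrite /row_free => /eqP ->.
    apply: inj_row_free => v.
    rewrite -[v](@hsubmxK _ 1 1 1) mul_row_col.
    rewrite [lsubmx v]mx11_scalar [rsubmx v]mx11_scalar !mul_scalar_mx.
    move: (lsubmx v 0 0) (rsubmx v 0 0) => c d e.
    have c0 : c = 0.
      have := congr1 (fun w => dot w (X *m 'J f (s q))) e.
      by rewrite dotDl !dotZl XX (dotC (Y *m _)) XY mulr1 mulr0 addr0 dot0l.
    have d0 : d = 0.
      have := congr1 (fun w => dot w (Y *m 'J f (s q))) e.
      by rewrite dotDl !dotZl YY XY mulr1 mulr0 add0r dot0l.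
    by rewrite c0 d0 !raddf0 row_mx0.
  move=> v; rewrite Jx => e; apply: (row_free_inj rk).
  by rewrite /mulmxr /= e mul0mx.
exists la; split => //.
  move=> v.
  have : (dder v x q <= col_mx (X *m 'J f (s q)) (Y *m 'J f (s q)))%MS.
    by apply: submx_trans le1; rewrite Jx submxMl.
  move=> /submxP[w]; rewrite -[w](@hsubmxK _ 1 1 1) mul_row_col.
  rewrite [lsubmx w]mx11_scalar [rsubmx w]mx11_scalar !mul_scalar_mx.
  move: (lsubmx w 0 0) (rsubmx w 0 0) => c d.
  rewrite (xE v Vq) (dderE _ sf Up) !scalemxAl -mulmxDl.
  move=> /(row_free_inj (jac_free fN Up)) ->.
  rewrite (dder_shape fN _ Up) mulmxDl -!scalemxAl XS YS.
  by rewrite !scalerA !(mulrC _ la) -!scalerA -scalerDr -scalemxAl scaleNr.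
move=> a perp; apply: ker.
  have /submxP[u e] : (X *m 'J f (s q) <= 'J (f \o s) q)%MS.
    apply: submx_trans le2; apply/submxP; exists (row_mx 1%:M 0).
    by rewrite mul_row_col mul1mx mul0mx addr0.
  by rewrite e -Jx dotC -(dderE _ sf Up) perp.
have /submxP[u e] : (Y *m 'J f (s q) <= 'J (f \o s) q)%MS.
  apply: submx_trans le2; apply/submxP; exists (row_mx 0 1%:M).
  by rewrite mul_row_col mul1mx mul0mx add0r.
by rewrite e -Jx dotC -(dderE _ sf Up) perp.
Qed.

Lemma integral_surface_normal q : V q -> exists2 la, la != 0 &
  forall u v, dot (dder u (dder v x) q) (nn q) = la * dot (dder u x q) (dder v x q).
Proof.
move=> Vq; have [_ [la [la0 nx _]]] := integral_surface_frame Vq.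
exists la => // u v.
have h : dder u (fun q => dot (dder v x q) (nn q)) q = 0.
  rewrite (dder_on oV (g := fun=> 0 : R) u Vq); first exact: dder_cst.
  by move=> r Vr; rewrite (xE v Vr); exact: (normal_tangent fN _ (sVU Vr)).
move: h; rewrite (dder_dot oV u (smooth_dder v sx) sn Vq) (nE u Vq) nx -(xE u Vq).
by rewrite dotZr mulNr => /eqP; rewrite subr_eq0 (dotC (dder v x q)) => /eqP.
Qed.

(** A normal vector w of the surface is t n + Z, with Z = f_a tangent to the
    hypersurface and a a nullity direction. The component along n is
    [integral_surface_normal]; for Z, the derivative of n_v = - la x_v gives
    <n_uv, Z> = - la <x_uv, Z>, and <n_uv, Z> is known from
    [nullity_second_form]. *)
Lemma integral_surface_umbilical q w : V q ->
  (forall v, dot (dder v x q) w = 0) -> exists mu, forall u v,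
  dot (dder u (dder v x) q) w = mu * dot (dder u x q) (dder v x q).
Proof.
move=> Vq wn; have Up := sVU Vq.
have [imm [la [la0 nx ker]]] := integral_surface_frame Vq.
have [la' _ hN] := integral_surface_normal Vq.
pose t := dot w (nn q).
have [a aE] : exists a, w - t *: nn q = dder a f (s q).
  apply: (tangentP fN Up).
  by rewrite dotBl dotZl (normal_unit fN Up) mulr1 subrr.
have xa v : dot (dder v x q) (dder a f (s q)) = 0.
  by rewrite -aE dotBr wn dotZr (xE v Vq) (normal_tangent fN _ Up) mulr0 subrr.
have aN := ker a xa.
pose e := dder 'e_0 s q.
have ef0 : dder e f (s q) != 0.
  rewrite -(xE _ Vq); apply/eqP => /imm /rowP /(_ 0).
  by rewrite !mxE /= => /eqP; rewrite oner_eq0.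
have [mu Hmu] := nullity_second_form oU sf sN (second_form_sym fN)
  (third_form_proportional bi) Up la0 aN ef0 (nx 'e_0).
have E0 : dot (dder 'e_0 x q) (dder 'e_0 x q) != 0.
  by rewrite (xE _ Vq) lt0r_neq0// dot_gt0.
exists (- mu / la + t * la') => u v.
have -> : w = dder a f (s q) + t *: nn q by rewrite -aE subrK.
rewrite dotDr dotZr hN.
have na v' : dot (dder v' nn q) (dder a f (s q)) = 0.
  by rewrite (nE v' Vq) (second_form_sym fN) // aN dot0l.
have n2 : dot (dder u (dder v nn) q) (dder a f (s q)) =
    mu * dot (dder u x q) (dder v x q).
  rewrite (dder_comp2 oV oU ss sN sVU u v Vq) dotDl (Hmu _ _ (nx u) (nx v)).
  rewrite -(xE u Vq) -(xE v Vq) (second_form_sym fN) // aN dot0l addr0//.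
have x2 : la * dot (dder u (dder v x) q) (dder a f (s q)) =
    - dot (dder u (dder v nn) q) (dder a f (s q)).
  pose Z := dder a f (s q).
  pose D v q := dder v nn q.
  have sZ := smooth_cst oV Z.
  have snv := smooth_dder v sn; have sxv := smooth_dder v sx.
  have sx0 := smooth_dder 'e_0 sx; have sn0 := smooth_dder 'e_0 sn.
  have nxv r v' : V r -> exists la, dder v' nn r = - la *: dder v' x r /\
      dder 'e_0 nn r = - la *: dder 'e_0 x r.
    move=> Vr; have [_ [l [_ nxr _]]] := integral_surface_frame Vr.
    by exists l; rewrite !(nE _ Vr) !nxr !(xE _ Vr).
  (* n_v = - la x_v with la eliminated by means of n_0 = - la x_0, so that only
     smooth functions are differentiated. *)
  have : dder u (fun r => dot (dder v nn r) Z * dot (dder 'e_0 x r) (dder 'e_0 x r)) q =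
      dder u (fun r => dot (dder 'e_0 nn r) (dder 'e_0 x r) * dot (dder v x r) Z) q.
    apply: (dder_on oV) => // r Vr; have [l [-> ->]] := nxv r v Vr.
    by rewrite !dotZl; ring.
  rewrite (dderM u (smoothR_dot oV snv sZ) (smoothR_dot oV sx0 sx0) Vq).
  rewrite (dderM u (smoothR_dot oV sn0 sx0) (smoothR_dot oV sxv sZ) Vq).
  rewrite (dder_dotc oV Z u snv Vq) (dder_dotc oV Z u sxv Vq) /Z na xa.
  rewrite (nE 'e_0 Vq) nx -(xE _ Vq) dotZl mul0r mulr0 addr0 add0r => h.
  apply: (mulIf E0); rewrite mulNr h; ring.
have -> : dot (dder u (dder v x) q) (dder a f (s q)) =
    la^-1 * (la * dot (dder u (dder v x) q) (dder a f (s q))).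
  by rewrite mulKf.
rewrite x2 n2; ring.
Qed.

(** The normal vector n provides the nonzero mean curvature. *)
Theorem integral_surface_spherical : open_part_of_2sphere (x @` V).
Proof.
apply: umbilical_surface_spherical => //.
- by case: int.
- by move=> q v Vq; have [imm _] := integral_surface_frame Vq; exact: imm.
- exact: integral_surface_umbilical.
move=> q Vq; have [la la0 h] := integral_surface_normal Vq.
exists (nn q).
  by move=> v; rewrite (xE v Vq); exact: (normal_tangent fN _ (sVU Vq)).
rewrite h mulf_neq0// lt0r_neq0// dot_gt0//; apply/eqP.
have [imm _] := integral_surface_frame Vq.
by move=> /imm /rowP /(_ 0); rewrite !mxE /= => /eqP; rewrite oner_eq0.
Qed.

End IntegralSurface.

(** * Hypersurfaces generated by a sphere *)

Section Lsub.
Variables (R : realType) (a b : nat) (O : set 'rV[R]_(a + b)).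
Hypothesis oO : open O.

Lemma smooth_lsub : smooth O (fun p : 'rV[R]_(a + b) => lsubmx p).
Proof.
apply: (smooth_eq oO _ (smooth_reindex oO (@lshift a b))) => p _.
by apply/rowP => j; rewrite !mxE.
Qed.

Lemma dder_lsub p v : O p ->
  dder v (fun p : 'rV[R]_(a + b) => lsubmx p) p = lsubmx v.
Proof.
move=> Op; apply/rowP => j; rewrite (dder_coord v j smooth_lsub Op) mxE.
rewrite -(dder_proj p v (lshift b j)); congr (dder v _ p).
by apply/funext => q; rewrite mxE.
Qed.

End Lsub.

Section SpherePatch.
Variables (R : realType) (k : nat) (c : 'rV[R]_k) (E : 'M[R]_(3, k)) (r : R).
Variables (D : set 'rV[R]_2) (z Nb : 'rV[R]_2 -> 'rV[R]_k).
Hypothesis sp : sphere_patch c E r D z Nb.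

Let oD : open D. Proof. by case: sp => _ _ []. Qed.
Let sz : smooth D z. Proof. by case: sp => _ _ []. Qed.
Let sNb : smooth D Nb. Proof. by case: sp => _ _ _ _ [[]]. Qed.
Let Jfree q : D q -> row_free ('J z q).
Proof. by case: sp => _ _ [_ _ +] _ _; apply. Qed.
Let NbNb q : D q -> dot (Nb q) (Nb q) = 1.
Proof. by case: sp => _ _ _ _ [[_ + _] _]; apply. Qed.
Let NbE q : D q -> (Nb q <= E)%MS.
Proof. by case: sp => _ _ _ _ [_]; apply. Qed.
Let zsph q : D q -> sphere2 c E r (z q).
Proof. by case: sp => _ _ _ + _; apply. Qed.

Lemma patch_normal q v : D q -> dot (dder v z q) (Nb q) = 0.
Proof.
by move=> Dq; rewrite (dderE v sz Dq); case: sp => _ _ _ _ [[_ _ +] _]; apply.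
Qed.

(** The columns of the cokernel of E are constant vectors orthogonal to z - c. *)
Lemma patch_tangent_sub q v : D q -> (dder v z q <= E)%MS.
Proof.
move=> Dq; rewrite submxE; apply/eqP/rowP => j; rewrite [RHS]mxE.
pose kj : 'rV[R]_k := (col j (cokermx E))^T.
have dotk w : (w *m cokermx E) 0 j = dot w kj.
  by rewrite mxE; apply: eq_bigr => i _; rewrite !mxE.
rewrite dotk.
have sc := smooth_cst oD c.
have <- : dder v (fun q => z q - c) q = dder v z q.
  by rewrite (dderB v sz sc Dq) dder_cst subr0.
rewrite -(dder_dotc oD kj v (smoothB oD sz sc) Dq).
rewrite (dder_on oD (g := fun=> 0 : R) v Dq); first exact: dder_cst.
move=> p Dp; rewrite -dotk; have [+ _] := zsph Dp.
by rewrite submxE => /eqP ->; rewrite mxE.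
Qed.

(** The signed radius: r or - r, according to the side to which Nb points. *)
Definition srad q := dot (z q - c) (Nb q).

(** The two derivatives of z and Nb span the 3-space, for dimension reasons. The
    vector z - c - srad Nb lies in that space and is orthogonal to all three,
    since |z - c|^2 is constant. *)
Lemma patch_radial q : D q -> z q - c = srad q *: Nb q.
Proof.
move=> Dq; apply/eqP; rewrite -subr_eq0; apply/eqP; set u := _ - _.
pose M : 'M[R]_(2 + 1, k) := col_mx ('J z q) (Nb q).
have JNb (v : 'rV[R]_2) : dot (v *m 'J z q) (Nb q) = 0.
  by rewrite -(dderE v sz Dq) patch_normal.
have Mfree : row_free M.
  apply: inj_row_free => v; rewrite -[v]hsubmxK mul_row_col.
  rewrite [rsubmx v]mx11_scalar mul_scalar_mx.
  move: (lsubmx v) (rsubmx v 0 0) => v1 v2 e.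
  have v20 : v2 = 0.
    have := congr1 (fun w => dot w (Nb q)) e.
    by rewrite dotDl dotZl JNb NbNb// mulr1 add0r dot0l.
  move: e; rewrite v20 scale0r addr0 => e.
  have -> : v1 = 0 by apply: (row_free_inj (Jfree Dq)); rewrite /mulmxr /= e mul0mx.
  by rewrite raddf0 row_mx0.
have ME : (M <= E)%MS.
  rewrite col_mx_sub NbE// andbT; apply/row_subP => i.
  by rewrite rowE -(dderE _ sz Dq) patch_tangent_sub.
have EM : (E <= M)%MS.
  rewrite -(geq_leqif (mxrank_leqif_sup ME)); move: Mfree => /eqP ->.
  exact: rank_leq_row.
have uE : (u <= E)%MS.
  by rewrite addmx_sub ?eqmx_opp ?scalemx_sub ?NbE//; have [] := zsph Dq.
have uNb : dot u (Nb q) = 0 by rewrite /u dotBl dotZl NbNb// mulr1 subrr.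
have uz v : dot (dder v z q) u = 0.
  rewrite /u dotBr dotZr patch_normal// mulr0 subr0.
  have sc := smooth_cst oD c.
  have sd := smoothB oD sz sc.
  have : dder v (fun q => dot (z q - c) (z q - c)) q = 0.
    rewrite (dder_on oD (g := fun=> r ^+ 2 : R) v Dq); first exact: dder_cst.
    by move=> p Dp; have [_] := zsph Dp.
  rewrite (dder_dot oD v sd sd Dq) (dderB v sz sc Dq) dder_cst subr0.
  by rewrite (dotC (z q - c)) => h; lra.
have /submxP[v uv] := submx_trans uE EM.
apply: dot_eq0; rewrite {1}uv -[v]hsubmxK mul_row_col dotDl.
rewrite -(dderE _ sz Dq) uz add0r [rsubmx v]mx11_scalar mul_scalar_mx dotZl.
by rewrite dotC uNb mulr0.
Qed.

Lemma srad_neq0 q : D q -> srad q != 0.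
Proof.
move=> Dq; have [_] := zsph Dq; rewrite (patch_radial Dq) dotZl dotZr NbNb//.
rewrite mulr1 => h; apply/eqP => s0; move: h; rewrite s0 mulr0 => /eqP.
by rewrite eq_sym expf_eq0 /= gt_eqF//; case: sp.
Qed.

(** Differentiate [patch_radial] and pair with Nb: as dz and d Nb are orthogonal to
    Nb, the derivative of srad vanishes. *)
Lemma dder_patch_normal q v : D q -> dder v Nb q = (srad q)^-1 *: dder v z q.
Proof.
move=> Dq.
have sc := smooth_cst oD c; have sd := smoothB oD sz sc.
have ss : smoothR D srad by exact: (smoothR_dot oD sd sNb).
have e : dder v z q = dder v srad q *: Nb q + srad q *: dder v Nb q.
  rewrite -(dderZ oD v ss sNb Dq) -(dder_on oD v Dq patch_radial).
  by rewrite (dderB v sz sc Dq) dder_cst subr0.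
have NbN : dot (dder v Nb q) (Nb q) = 0.
  have : dder v (fun q => dot (Nb q) (Nb q)) q = 0.
    by rewrite (dder_on oD (g := fun=> 1 : R) v Dq); [exact: dder_cst|exact: NbNb].
  by rewrite (dder_dot oD v sNb sNb Dq) (dotC (Nb q)) => h; lra.
have s0 : dder v srad q = 0.
  have := patch_normal v Dq; rewrite e dotDl !dotZl NbN NbNb//.
  by rewrite mulr0 mulr1 addr0.
by rewrite e s0 scale0r add0r scalerA mulVf ?scale1r// srad_neq0.
Qed.

Lemma smoothR_srad : smoothR D srad.
Proof.
exact: (smoothR_dot oD (smoothB oD sz (smooth_cst oD c)) sNb).
Qed.

End SpherePatch.

Section Generated.
Variables (R : realType) (m : nat).
Let k := m.+4.
Variables (c : 'rV[R]_k) (E : 'M[R]_(3, k)) (r : R).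
Variables (D : set 'rV[R]_2) (z Nb : 'rV[R]_2 -> 'rV[R]_k).
Variables (e : 'M[R]_(m.+1, k)) (alpha : R).
Hypothesis sp : sphere_patch c E r D z Nb.
Hypothesis oc : orthonormal_basis_of_complement E e.
Hypothesis ca : cos alpha != 0.

Let oD : open D. Proof. by case: sp => _ _ []. Qed.
Let sz : smooth D z. Proof. by case: sp => _ _ []. Qed.
Let sNb : smooth D Nb. Proof. by case: sp => _ _ _ _ [[]]. Qed.

Local Notation F := (generated e alpha z Nb).
Local Notation rho := (srad c z Nb).
Local Notation g := (gen_frame e alpha Nb).

Lemma e_orthonormal i j : dot (row i e) (row j e) = (i == j)%:R.
Proof. by case: oc => _ + _; apply. Qed.

Lemma sphere_space_perp i w : (w <= E)%MS -> dot w (row i e) = 0.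
Proof.
move=> /submxP[v ->]; rewrite mulmx_sum_row dot_suml big1// => j _.
by rewrite dotC; case: oc => _ _ ->; rewrite mulr0.
Qed.

Lemma Nb_perp q i : D q -> dot (Nb q) (row i e) = 0.
Proof. by move=> Dq; apply: sphere_space_perp; case: sp => _ _ _ _ [_]; apply. Qed.

Lemma z_perp q v i : D q -> dot (dder v z q) (row i e) = 0.
Proof. by move=> Dq; apply: sphere_space_perp; exact: (patch_tangent_sub sp). Qed.

(** The factor by which dF scales the sphere directions; its zeros are the focal
    points of the rulings. *)
Definition stretch (p : 'rV[R]_(2 + m.+1)) : R :=
  1 - sin alpha * (rsubmx p 0 0 / rho (lsubmx p)).

(** A unit vector orthogonal to e_1 in the plane of Nb and e. *)
Definition gen_normal (p : 'rV[R]_(2 + m.+1)) : 'rV[R]_k :=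
  cos alpha *: Nb (lsubmx p) + sin alpha *: row 0 e.

Lemma smooth_gen_frame i : smooth D (g i).
Proof.
rewrite /gen_frame; case: eqP => _; last exact: smooth_cst.
apply: smoothD => //; last exact: smooth_cst.
by apply: smoothZ => //; exact: smoothR_cst.
Qed.

Lemma dder_gen_frame i q v : D q ->
  dder v (g i) q = (if i == 0 then - sin alpha / rho q else 0) *: dder v z q.
Proof.
move=> Dq; rewrite /gen_frame; case: eqP => _; last by rewrite dder_cst scale0r.
have s1 := smoothZ oD (smoothR_cst oD (- sin alpha)) sNb.
rewrite (dderD v s1 (smooth_cst oD _) Dq) dder_cst addr0.
rewrite (dderZ oD v (smoothR_cst oD _) sNb Dq) dder_cst scale0r add0r.
by rewrite (dder_patch_normal sp v Dq) scalerA.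
Qed.

Lemma frame_row i j q : D q ->
  dot (g i q) (row j e) = (if i == 0 then cos alpha else 1) * (i == j)%:R.
Proof.
move=> Dq; rewrite /gen_frame; case: eqP => [->|_]; last by rewrite e_orthonormal mul1r.
by rewrite dotDl !dotZl Nb_perp// mulr0 add0r e_orthonormal.
Qed.

Lemma frame_normal i p : D (lsubmx p) -> dot (g i (lsubmx p)) (gen_normal p) = 0.
Proof.
move=> Dq; rewrite /gen_frame /gen_normal.
have NN : dot (Nb (lsubmx p)) (Nb (lsubmx p)) = 1.
  by case: sp => _ _ _ _ [[_ + _] _]; apply.
have NC j : dot (row j e) (Nb (lsubmx p)) = 0 by rewrite dotC Nb_perp.
case: eqP => [_|i0].
  rewrite !(dotDl, dotDr) !(dotZl, dotZr) NN NC Nb_perp// e_orthonormal eqxx.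
  by rewrite (_ : true%:R = 1 :> R)//; ring.
rewrite !dotDr !dotZr NC e_orthonormal; have /negbTE -> : i != 0 by exact/eqP.
by rewrite !mulr0 addr0.
Qed.

(** The domain O is a parameter because the formulas are needed twice: on the
    preimage of D to show that the regular domain is open, and then on the regular
    domain itself. *)
Section OnDomain.
Variable O : set 'rV[R]_(2 + m.+1).
Hypotheses (oO : open O) (OD : forall p, O p -> D (lsubmx p)).

Let sl := smooth_lsub oO.

Let scoord i : smoothR O (fun p : 'rV[R]_(2 + m.+1) => rsubmx p 0 i).
Proof.
by apply: (smoothR_eq oO _ (smoothR_proj oO (rshift 2 i))) => p _; rewrite mxE.
Qed.

Let dder_rcoord i p v : dder v (fun p : 'rV[R]_(2 + m.+1) => rsubmx p 0 i) p =
  rsubmx v 0 i.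
Proof.
rewrite mxE -(dder_proj p v (rshift 2 i)); congr (dder v _ p).
by apply/funext => q; rewrite mxE.
Qed.

Let szl : smooth O (fun p => z (lsubmx p)) := smooth_comp oO oD sl OD sz.

Let sgl i : smooth O (fun p => g i (lsubmx p)) :=
  smooth_comp oO oD sl OD (smooth_gen_frame i).

Lemma smooth_generated : smooth O F.
Proof.
apply: smoothD => //; apply: smooth_sum => // i.
by apply: smoothZ.
Qed.

Lemma smooth_gen_normal : smooth O gen_normal.
Proof.
apply: smoothD => //; last exact: smooth_cst.
apply: smoothZ => //; first exact: smoothR_cst.
exact: (smooth_comp oO oD sl OD sNb).
Qed.

Lemma smoothR_stretch : smoothR O stretch.
Proof.
apply: smoothR_B => //; first exact: smoothR_cst.
apply: smoothR_M => //; first exact: smoothR_cst.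
apply: smoothR_M => //.
have srho := smoothR_srad sp.
apply: smoothR_V => //; first by move=> p /OD Dp; exact: (srad_neq0 sp).
exact: (smoothR_comp oO sl OD srho).
Qed.

Lemma dder_generated p v : O p ->
  dder v F p = stretch p *: dder (lsubmx v) z (lsubmx p) +
    \sum_i rsubmx v 0 i *: g i (lsubmx p).
Proof.
move=> Op; have Dp := OD Op.
have s1 i := smoothZ oO (scoord i) (sgl i).
have ddl (h : 'rV[R]_2 -> 'rV[R]_k) : smooth D h ->
    dder v (fun p => h (lsubmx p)) p = dder (lsubmx v) h (lsubmx p).
  move=> sh; rewrite (dder_comp sl v Op (smooth_diff sh Dp)).
  by rewrite (dder_lsub oO v Op).
have -> : dder v F p = dder v (fun p => z (lsubmx p)) p +
    \sum_i dder v (fun p => rsubmx p 0 i *: g i (lsubmx p)) p.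
  rewrite -(dder_sum (U := O) v s1 Op).
  by rewrite -(dderD v szl (smooth_sum oO s1) Op).
rewrite (ddl _ sz).
under eq_bigr => i _.
  rewrite (dderZ oO v (scoord i) (sgl i) Op) dder_rcoord.
  rewrite (ddl _ (smooth_gen_frame i)) (dder_gen_frame i _ Dp) scalerA.
  over.
rewrite big_split /= addrCA addrC; congr (_ + _).
rewrite -scaler_suml -{1}[dder _ z _]scale1r -scalerDl; congr (_ *: _).
rewrite /stretch big_ord_recl eqxx big1 ?addr0//; last by move=> i _; rewrite mulr0.
by congr (_ + _); ring.
Qed.

Lemma dder_gen_normal p v : O p ->
  dder v gen_normal p = (cos alpha / rho (lsubmx p)) *: dder (lsubmx v) z (lsubmx p).
Proof.
move=> Op; have Dp := OD Op.
have sNl := smooth_comp oO oD sl OD sNb.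
have s1 := smoothZ oO (smoothR_cst oO (cos alpha)) sNl.
rewrite (dderD v s1 (smooth_cst oO _) Op) dder_cst addr0.
rewrite (dderZ oO v (smoothR_cst oO _) sNl Op) dder_cst scale0r add0r.
rewrite (dder_comp sl v Op (smooth_diff sNb Dp)) (dder_lsub oO v Op).
by rewrite (dder_patch_normal sp _ Dp) scalerA.
Qed.

Let tangent_free q v : D q -> dder v z q = 0 -> v = 0.
Proof.
move=> Dq; rewrite (dderE v sz Dq) => h.
have Jf : row_free ('J z q) by case: sp => _ _ [_ _ +] _ _; apply.
by apply: (row_free_inj Jf); rewrite /mulmxr /= h mul0mx.
Qed.

(** The sphere directions and the rulings are orthogonal, and the generators e_i are
    independent as cos alpha is nonzero; so only the factor [stretch] can make the
    differential degenerate. *)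
Lemma generated_regular p : O p -> row_free ('J F p) = (stretch p != 0).
Proof.
move=> Op; have Dp := OD Op; apply/idP/idP => [Jf|s0].
  apply/eqP => s0.
  have : row_mx 'e_0 0 = 0 :> 'rV[R]_(2 + m.+1).
    apply: (row_free_inj Jf); rewrite /mulmxr /= mul0mx.
    rewrite -(dderE _ smooth_generated Op) (dder_generated _ Op) s0 scale0r add0r.
    by rewrite row_mxKr big1// => i _; rewrite mxE scale0r.
  move/(congr1 lsubmx); rewrite row_mxKl => /rowP /(_ 0).
  by rewrite !mxE /= => /eqP; rewrite oner_eq0.
apply: inj_row_free => v; rewrite -(dderE _ smooth_generated Op) (dder_generated _ Op).
move=> h.
have vr i : rsubmx v 0 i = 0.
  have := congr1 (fun w => dot w (row i e)) h.
  rewrite dotDl dotZl z_perp// mulr0 add0r dot_suml dot0l.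
  rewrite (bigD1 i)//= big1 ?addr0; last first.
    by move=> j /negbTE ji; rewrite frame_row// ji !mulr0.
  rewrite frame_row// eqxx mulr1 => /eqP; rewrite mulf_eq0 => /orP[/eqP//|].
  by case: ifP => _; rewrite ?oner_eq0// (negbTE ca).
move: h; rewrite big1 ?addr0; last by move=> i _; rewrite vr scale0r.
move/eqP; rewrite scaler_eq0 (negbTE s0) /= => /eqP /(tangent_free Dp) vl.
rewrite -[v]hsubmxK vl; have -> : rsubmx v = 0 by apply/rowP => i; rewrite vr mxE.
by rewrite row_mx0.
Qed.

End OnDomain.

Let O0 : set 'rV[R]_(2 + m.+1) := [set p | D (lsubmx p)].

Let oO0 : open O0.
Proof.
apply: (@open_comp _ _ (fun p : 'rV[R]_(2 + m.+1) => lsubmx p)) => // p _.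
exact: continuous_lsubmx.
Qed.

Local Notation W := (regular_domain D F).

Lemma regular_domainE : W = [set p | D (lsubmx p) /\ stretch p != 0].
Proof.
apply/seteqP; split => p [Dp h]; split => //.
  by rewrite -(generated_regular oO0 (fun p h => h) Dp).
by rewrite (generated_regular oO0 (fun p h => h) Dp).
Qed.

Lemma open_regular_domain : open W.
Proof.
rewrite regular_domainE openE => p [Dp s0].
have cs := smoothR_cont (smoothR_stretch oO0 (fun p h => h)) Dp.
have nD : nbhs p O0 by exact: open_nbhs_nbhs.
have ns : \forall q \near p, stretch q != 0 by exact: (cvgr_neq0 _ cs s0).
by apply: filterS2 nD ns => q.
Qed.

Lemma sphere_in_regular_domain q : D q -> W (row_mx q 0).
Proof.
move=> Dq; rewrite regular_domainE; split; rewrite /= ?row_mxKl//.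
by rewrite /stretch row_mxKr mxE mul0r mulr0 subr0 oner_eq0.
Qed.

Let WD p : W p -> D (lsubmx p). Proof. by case. Qed.
Let oW := open_regular_domain.
Let sFW := smooth_generated oW WD.
Let sNW := smooth_gen_normal oW WD.

Lemma generated_hypersurface : hypersurface W F gen_normal.
Proof.
split; split => //.
- by move=> p [].
- move=> p [Dp _]; rewrite /gen_normal !(dotDl, dotDr) !(dotZl, dotZr).
  rewrite (dotC (row 0 e)) Nb_perp// e_orthonormal eqxx.
  have -> : dot (Nb (lsubmx p)) (Nb (lsubmx p)) = 1.
    by case: sp => _ _ _ _ [[_ + _] _]; apply.
  by rewrite !mulr1 !mulr0 addr0 add0r -!expr2 cos2Dsin2.
- move=> p Wp v; rewrite -(dderE v sFW Wp) (dder_generated oW WD v Wp).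
  rewrite dotDl dotZl dot_suml big1 ?addr0; last first.
    by move=> i _; rewrite frame_normal ?mulr0//; exact: WD.
  rewrite dotDr !dotZr z_perp ?(patch_normal sp) ?mulr0 ?addr0 ?mulr0//; exact: WD.
Qed.

(** On the sphere directions, - d gen_normal = gen_curv dF. *)
Definition gen_curv p := - (cos alpha / (rho (lsubmx p) * stretch p)).

Lemma gen_curv_neq0 p : W p -> gen_curv p != 0.
Proof.
rewrite regular_domainE => -[Dp s0].
by rewrite oppr_eq0 mulf_neq0// invr_eq0 mulf_neq0// (srad_neq0 sp).
Qed.

Lemma generated_shape p : W p -> shape_operator F gen_normal p =
  (block_mx ((gen_curv p)%:M : 'M[R]_2) 0 0 (0 : 'M[R]_(m.+1)) : 'M[R]_(2 + m.+1)).
Proof.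
move=> Wp; set S := block_mx _ _ _ _.
have [Dp s0] : D (lsubmx p) /\ stretch p != 0 by rewrite regular_domainE in Wp.
have rho0 := srad_neq0 sp Dp.
have Jf : row_free ('J F p) by case: Wp.
have SJ : S *m 'J F p = - 'J gen_normal p.
  apply/row_matrixP => i; rewrite linearN /= row_mul !rowE.
  set v : 'rV[R]_(2 + m.+1) := delta_mx 0 i.
  have vS : v *m S = row_mx (gen_curv p *: lsubmx v) 0.
    rewrite -{1}[v]hsubmxK mul_row_block !mulmx0 !addr0 mul_mx_scalar.
    by [].
  rewrite vS -(dderE _ sFW Wp) -(dderE _ sNW Wp) (dder_generated oW WD _ Wp).
  rewrite (dder_gen_normal oW WD _ Wp) row_mxKl row_mxKr big1 ?addr0; last first.
    by move=> j _; rewrite mxE scale0r.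
  rewrite !(dderE _ sz Dp) -scalemxAl scalerA -scaleNr; congr (_ *: _).
  by rewrite /gen_curv; field; rewrite rho0 s0.
by rewrite /shape_operator -SJ -mulmxA mulmxVp// mulmx1.
Qed.

Lemma generated_char_poly p : W p ->
  char_poly (shape_operator F gen_normal p) =
  ('X - (gen_curv p)%:P) * ('X - (gen_curv p)%:P) * 'X^(m.+3 - 2).
Proof.
move=> Wp; rewrite (generated_shape Wp) /char_poly.
rewrite [char_poly_mx _](char_block_diag_mx (gen_curv p)%:M (0 : 'M[R]_(m.+1))).
rewrite det_ublock; congr (_ * _).
  by rewrite /char_poly_mx map_scalar_mx /= -raddfB det_scalar expr2.
by rewrite /char_poly_mx map_mx0 subr0 det_scalar.
Qed.

(** [gen_curv] is the only nonzero root of the characteristic polynomial. *)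
Lemma generated_bi_umbilical : bi_umbilical W F gen_normal.
Proof.
split; first split.
- exact: generated_hypersurface.
- move=> p Wp; exists (gen_curv p), (gen_curv p).
  by split; [exact: gen_curv_neq0|exact: gen_curv_neq0|exact: generated_char_poly].
move=> p Wp; have root nu nu' : nonzero_curvatures F gen_normal p nu nu' ->
    nu = gen_curv p.
  move=> [nu0 _]; rewrite (generated_char_poly Wp) => /(congr1 (horner^~ nu)).
  rewrite !hornerM !hornerXsubC subrr !mul0r => /eqP.
  rewrite !mulf_eq0 hornerXn expf_eq0 (negbTE nu0) andbF orbF orbb subr_eq0.
  by move/eqP.
move=> nu1 nu2 h; rewrite (root _ _ h); apply/esym; apply: (root nu2 nu1).
by have [h1 h2 h3] := h; split => //; rewrite h3 (mulrC ('X - _)).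
Qed.

End Generated.

(* The dimension n >= 3 of the hypersurface is m.+3. If cos alpha = 0, the
   generated hypersurface is an open part of a hyperplane. *)
Theorem theorem3p1 (R : realType) (m : nat) :
  (forall (U : set 'rV[R]_m.+3) (f N : 'rV[R]_m.+3 -> 'rV[R]_m.+4)
      (V : set 'rV[R]_2) (s : 'rV[R]_2 -> 'rV[R]_m.+3),
    bi_umbilical U f N ->
    integral_surface f N U V s ->
    open_part_of_2sphere ((f \o s) @` V)) /\
  (forall (c : 'rV[R]_m.+4) (E : 'M[R]_(3, m.+4)) (r : R)
      (D : set 'rV[R]_2) (z Nb : 'rV[R]_2 -> 'rV[R]_m.+4)
      (e : 'M[R]_(m.+1, m.+4)) (alpha : R),
    sphere_patch c E r D z Nb ->
    orthonormal_basis_of_complement E e ->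
    cos alpha != 0 ->
    let F := generated e alpha z Nb in
    let W := regular_domain D F in
    (forall q, D q -> W (row_mx q 0)) /\
    exists N : 'rV[R]_m.+3 -> 'rV[R]_m.+4, bi_umbilical W F N).
Proof.
split=> [U f N V s bi int|c E r D z Nb e alpha sp oc ca /=].
  exact: integral_surface_spherical bi int.
split; first exact: (sphere_in_regular_domain sp oc ca).
exists (gen_normal Nb e alpha); exact: (generated_bi_umbilical sp oc ca).
Qed.
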